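(* For all integers $m,n\ge1$ and every function $\Psi:\mathbb{Z}^n\to\mathbb{R}_{>0}$, each of the three sets $\mathcal{A}_{n,m}(\Psi)$, $\mathcal{A}'_{n,m}(\Psi)$ and $\mathcal{A}''_{n,m}(\Psi)$ has $nm$-dimensional Lebesgue measure equal to $0$ or $1$.
   Context: Let $m,n\ge1$ be integers. Points $\mathbf{X}\in[0,1]^{nm}$ are regarded as real $n\times m$ matrices, $\mathbf{q}\in\mathbb{Z}^n$ as a row vector, so $\mathbf{q}\mathbf{X}\in\mathbb{R}^m$; $|\cdot|$ denotes the supremum norm on $\mathbb{R}^m$. For $\Psi:\mathbb{Z}^n\to\mathbb{R}_{>0}$ consider the inequality ( * ) $|\mathbf{q}\mathbf{X}+\mathbf{p}|<\Psi(\mathbf{q})$, with $\mathbf{p}=(p_1,\dots,p_m)\in\mathbb{Z}^m$, $\mathbf{q}\in\mathbb{Z}^n\setminus\{\mathbf{0}\}$. $\mathcal{A}_{n,m}(\Psi)$ is the set of $\mathbf{X}\in[0,1]^{nm}$ for which ( * ) holds for infinitely many pairs $(\mathbf{p},\mathbf{q})$; $\mathcal{A}'_{n,m}(\Psi)$ is the set of $\mathbf{X}\in[0,1]^{nm}$ for which ( * ) holds for infinitely many $(\mathbf{p},\mathbf{q})$ with $\gcd(\mathbf{p},\mathbf{q})=1$ (the gcd of all components of $\mathbf{p}$ and $\mathbf{q}$); $\mathcal{A}''_{n,m}(\Psi)$ is the set of $\mathbf{X}\in[0,1]^{nm}$ for which ( * ) holds for infinitely many $(\mathbf{p},\mathbf{q})$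 with $\gcd(p_j,\mathbf{q})=1$ for every $j=1,\dots,m$ (gcd of $p_j$ and all components of $\mathbf{q}$). *)

(* Defs.v *)
From Stdlib Require Import Reals ZArith List.
Open Scope R_scope.

(** Real n x m matrices: X i j for i < n, j < m (other entries irrelevant). *)
Definition mat := nat -> nat -> R.

Fixpoint sumR (n : nat) (f : nat -> R) : R :=
  match n with O => 0 | S k => sumR k f + f k end.
Fixpoint prodR (n : nat) (f : nat -> R) : R :=
  match n with O => 1 | S k => prodR k f * f k end.

Definition in_cube (n m : nat) (X : mat) : Prop :=
  forall i j, (i < n)%nat -> (j < m)%nat -> 0 <= X i j <= 1.

Record box := Box { lo : mat; hi : mat }.
Definition in_box (n m : nat) (B : box) (X : mat) : Prop :=
  forall i j, (i < n)%nat -> (j < m)%nat -> lo B i j <= X i j <= hi B i j.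
Definition vol (n m : nat) (B : box) : R :=
  prodR n (fun i => prodR m (fun j => Rmax 0 (hi B i j - lo B i j))).

(** [outer_le n m A s]: A is covered by countably many boxes of total
    volume at most s; the Lebesgue outer measure of A is the infimum of such s. *)
Definition outer_le (n m : nat) (A : mat -> Prop) (s : R) : Prop :=
  exists C : nat -> box,
    (forall X, A X -> exists k, in_box n m (C k) X) /\
    (forall N, sum_f_R0 (fun k => vol n m (C k)) N <= s).

Definition measure_zero (n m : nat) (A : mat -> Prop) : Prop :=
  forall eps, 0 < eps -> outer_le n m A eps.
Definition measure_one (n m : nat) (A : mat -> Prop) : Prop :=
  (forall eps, 0 < eps -> outer_le n m A (1 + eps)) /\
  (forall s, outer_le n m A s -> 1 <= s).

Definition zvec (n : nat) (v : list Z) : Prop := length v = n.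
Definition nonzero (v : list Z) : Prop := exists z, In z v /\ z <> 0%Z.

Definition qXp (n : nat) (q : list Z) (X : mat) (p : list Z) (j : nat) : R :=
  sumR n (fun i => IZR (nth i q 0%Z) * X i j) + IZR (nth j p 0%Z).

Definition supnorm_qXp (n m : nat) (q : list Z) (X : mat) (p : list Z) : R :=
  fold_right Rmax 0 (map (fun j => Rabs (qXp n q X p j)) (seq 0 m)).

Definition ineq (n m : nat) (Psi : list Z -> R) (X : mat) (p q : list Z) : Prop :=
  zvec m p /\ zvec n q /\ nonzero q /\ supnorm_qXp n m q X p < Psi q.

Definition gcdl (l : list Z) : Z := fold_right Z.gcd 0%Z l.

Definition infinitely_many (P : list Z -> list Z -> Prop) : Prop :=
  ~ exists L : list (list Z * list Z), forall p q, P p q -> In (p, q) L.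

Definition A_set (n m : nat) (Psi : list Z -> R) (X : mat) : Prop :=
  in_cube n m X /\ infinitely_many (fun p q => ineq n m Psi X p q).

Definition A'_set (n m : nat) (Psi : list Z -> R) (X : mat) : Prop :=
  in_cube n m X /\
  infinitely_many (fun p q => ineq n m Psi X p q /\ gcdl (p ++ q) = 1%Z).

Definition A''_set (n m : nat) (Psi : list Z -> R) (X : mat) : Prop :=
  in_cube n m X /\
  infinitely_many (fun p q => ineq n m Psi X p q /\
     forall j, (j < m)%nat -> gcdl (nth j p 0%Z :: q) = 1%Z).

Definition zero_or_one (n m : nat) (A : mat -> Prop) : Prop :=
  measure_zero n m A \/ measure_one n m A.

(* Main.v *)
Require Import Defs.
From Stdlib Require Import Reals ZArith List.
From Stdlib Require Import Lra Lia Zfloor Znumtheory Cantor FinFun.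
From Stdlib Require Import Classical ClassicalEpsilon IndefiniteDescription.
From Stdlib Require Import FunctionalExtensionality.
Open Scope R_scope.

(** Suppose the outer measure of the set is [s < 1].  If every cell of arbitrarily fine
    grids meets a set in outer measure at most a fixed fraction [th < 1] of its volume, the
    set is null.  Porous sets are null by this criterion, so replacing [Psi] by [c Psi]
    changes the limsup set by a null set only, provided [Psi q / |q| -> 0] (Cassels).

    Fix a prime [l] and, following Gallagher, split the solutions according to whether [l]
    does not divide [q], divides [q] while [l^2] does not divide some entry [q_i], or [l^2]
    divides [q].  The maps [X -> l X], respectively [X -> l X + E_i / l] with [E_i] the matrix
    whose [i]-th row is all 1, preserve the first two kinds up to multiplying [Psi] by [l];
    being expanding they spread the bound [s] to all small cells, so these limsup sets are
    null.  The third kind is invariant under translation by [Z / l] in each coordinate; it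
    carries the whole measure for every [l], and letting [l -> oo] gives measure zero.

    If [Psi q >= eps |q|] for infinitely many [q], short intervals contain integers prime
    to [q], and the limsup set is the whole cube. *)

(** All sets are handled through outer measure alone: no limsup set is shown to be measurable, so
    Lebesgue density is replaced by bounds valid in every cell of a grid, and the zero-one law takes
    the form that a cover of total volume below 1 forces measure zero. The obstacle is that
    rescaling interferes with coprimality. Multiplying [X] by [l] multiplies [p] by [l], which
    destroys the condition at the prime [l] as soon as [l] divides [q]. If [l] does not divide [q],
    there is no condition at [l]. If [l] divides [q] but [l^2] does not divide [q_i], the shift by
    [E_i / l] subtracts [q_i / l] from the numerators, and they become units modulo [l]. If [l^2]
    divides [q], neither device helps, but a translation by [Z / l] changes the numerators by
    multiples of every prime dividing [q]. Each expanding map costs a factor [l] on [Psi]; porosity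
    is what absorbs it. The holes sit around exact zeros of the linear forms: there the inequality
    for [Psi] itself has a solution, which a point with no further solutions cannot have. *)

Lemma sumR_succ n f : sumR (S n) f = sumR n f + f n.
Proof. reflexivity. Qed.

Lemma sumR_ext n f g : (forall i, (i < n)%nat -> f i = g i) -> sumR n f = sumR n g.
Proof.
  induction n as [|n IH]; intros H; simpl; auto.
  rewrite IH by (intros; apply H; lia); rewrite H by lia; auto.
Qed.

Lemma sumR_le n f g : (forall i, (i < n)%nat -> f i <= g i) -> sumR n f <= sumR n g.
Proof.
  induction n as [|n IH]; intros H; simpl; [lra|].
  pose proof (IH ltac:(intros; apply H; lia)); pose proof (H n ltac:(lia)); lra.
Qed.

Lemma sumR_const n c : sumR n (fun _ => c) = INR n * c.
Proof. induction n; [simpl; lra|]. rewrite S_INR; simpl; lra. Qed.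

Lemma sumR_plus n f g : sumR n (fun i => f i + g i) = sumR n f + sumR n g.
Proof. induction n; simpl; lra. Qed.

Lemma sumR_scal n c f : sumR n (fun i => c * f i) = c * sumR n f.
Proof. induction n; simpl; lra. Qed.

Lemma sumR_swap a b (f : nat -> nat -> R) :
  sumR a (fun i => sumR b (f i)) = sumR b (fun j => sumR a (fun i => f i j)).
Proof.
  induction a as [|a IH]; simpl.
  - rewrite sumR_const; lra.
  - rewrite IH, <- sumR_plus; auto.
Qed.

Lemma sumR_succ_l n f : sumR (S n) f = f 0%nat + sumR n (fun i => f (S i)).
Proof. induction n; simpl in *; lra. Qed.

Lemma sumR_widen f a b :
  (forall i, 0 <= f i) -> (a <= b)%nat -> sumR a f <= sumR b f.
Proof.
  intros H; induction 1 as [|b _ IH]; simpl; [lra|]; pose proof (H b); lra.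
Qed.

Lemma sum_f_R0_sumR f K : sum_f_R0 f K = sumR (S K) f.
Proof. induction K; simpl in *; lra. Qed.

Lemma sumR_indicator n f j :
  (j < n)%nat -> sumR n (fun i => if (i =? j)%nat then f i else 0) = f j.
Proof.
  induction n as [|n IH]; [lia|]; intros Hj; simpl.
  destruct (Nat.eqb_spec n j) as [->|Hn].
  - rewrite (sumR_ext _ _ (fun _ => 0)).
    + rewrite sumR_const; lra.
    + intros i Hi; destruct (Nat.eqb_spec i j); [lia|auto].
  - rewrite IH by lia; lra.
Qed.

Lemma sumR_geometric K eps : 0 <= eps ->
  sumR K (fun k => eps * (1/2)^(S k)) <= eps.
Proof.
  intros He.
  assert (H : sumR K (fun k => eps * (1/2)^(S k)) = eps * (1 - (1/2)^K)).
  { induction K as [|K IH]; [simpl; lra|]. rewrite sumR_succ, IH; simpl; lra. }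
  rewrite H. pose proof (pow_le (1/2) K ltac:(lra)). nra.
Qed.

Lemma prodR_ext n f g : (forall i, (i < n)%nat -> f i = g i) -> prodR n f = prodR n g.
Proof.
  induction n as [|n IH]; intros H; simpl; auto.
  rewrite IH by (intros; apply H; lia); rewrite H by lia; auto.
Qed.

Lemma prodR_nonneg n f : (forall i, (i < n)%nat -> 0 <= f i) -> 0 <= prodR n f.
Proof.
  induction n as [|n IH]; intros H; simpl; [lra|].
  apply Rmult_le_pos; [apply IH; intros; apply H; lia | apply H; lia].
Qed.

Lemma prodR_const n c : prodR n (fun _ => c) = c ^ n.
Proof. induction n as [|n IH]; simpl; [auto|]; rewrite IH; ring. Qed.

Lemma prodR_mul n f g : prodR n (fun i => f i * g i) = prodR n f * prodR n g.
Proof. induction n as [|n IH]; simpl; [lra|]; rewrite IH; ring. Qed.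

Lemma prodR_app a b f : prodR (a + b) f = prodR a f * prodR b (fun i => f (a + i)%nat).
Proof.
  induction b as [|b IH]; simpl.
  - rewrite Nat.add_0_r; ring.
  - rewrite Nat.add_succ_r; simpl; rewrite IH; ring.
Qed.

Lemma prodR_split n j f : (j < n)%nat ->
  prodR n f = prodR n (fun i => if (i =? j)%nat then 1 else f i) * f j.
Proof.
  induction n as [|n IH]; [lia|]; intros Hj; simpl.
  destruct (Nat.eqb_spec n j) as [->|Hn].
  - rewrite (prodR_ext j f (fun i => if (i =? j)%nat then 1 else f i)); [ring|].
    intros i Hi; destruct (Nat.eqb_spec i j); [lia|auto].
  - rewrite IH by lia; ring.
Qed.

Lemma prodR_nested n m f :
  prodR n (fun i => prodR m (fun j => f (i * m + j)%nat)) = prodR (n * m) f.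
Proof.
  induction n as [|n IH]; simpl; auto.
  now rewrite IH, Nat.add_comm, prodR_app.
Qed.

(** Continuity of the volume: it bounds the excess incurred when a box is enlarged to the union of
    the cells of side [d] that it meets. *)
Lemma prodR_perturb N f eps : (forall i, 0 <= f i) -> 0 < eps ->
  exists eta, 0 < eta /\ forall d, 0 < d < eta ->
    prodR N (fun i => f i + 2 * d) <= prodR N f + eps.
Proof.
  intros Hf; revert eps; induction N as [|N IH]; intros eps He; simpl.
  - exists 1; split; [lra|]; intros; lra.
  - pose proof (Hf N) as HN.
    pose proof (prodR_nonneg N f ltac:(auto)) as HP.
    set (P := prodR N f) in *.
    set (e1 := eps / (2 * (f N + 1))).
    assert (He1 : 0 < e1) by (apply Rdiv_lt_0_compat; lra).
    assert (E1 : e1 * (f N + 1) = eps / 2) by (unfold e1; field; lra).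
    destruct (IH e1 He1) as [eta [Heta H]].
    set (e2 := eps / (4 * (P + e1 + 1))).
    assert (He2 : 0 < e2) by (apply Rdiv_lt_0_compat; lra).
    assert (E2 : e2 * (P + e1 + 1) = eps / 4) by (unfold e2; field; lra).
    exists (Rmin eta e2); split; [apply Rmin_glb_lt; lra|].
    intros d [Hd0 Hd].
    pose proof (Rmin_l eta e2); pose proof (Rmin_r eta e2).
    pose proof (H d ltac:(lra)) as Hd'.
    apply Rle_trans with ((P + e1) * (f N + 2 * d)).
    + apply Rmult_le_compat_r; lra.
    + nra.
Qed.

(** * Outer measure on the first [N] coordinates *)

Definition pt := nat -> R.

Definition bvol (N : nat) (lo hi : pt) : R :=
  prodR N (fun i => Rmax 0 (hi i - lo i)).

Definition outer (N : nat) (D : pt -> Prop) (s : R) : Prop :=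
  exists lo hi : nat -> pt,
    (forall x, D x -> exists k, forall i, (i < N)%nat -> lo k i <= x i <= hi k i) /\
    (forall K, sumR K (fun k => bvol N (lo k) (hi k)) <= s).

Definition null (N : nat) (D : pt -> Prop) : Prop :=
  forall eps, 0 < eps -> outer N D eps.

Lemma bvol_nonneg N lo hi : 0 <= bvol N lo hi.
Proof. apply prodR_nonneg; intros; apply Rmax_l. Qed.

Lemma outer_nonneg N D s : outer N D s -> 0 <= s.
Proof. intros (lo & hi & _ & H); apply (H 0%nat). Qed.

Lemma outer_mono N (D E : pt -> Prop) s t :
  (forall x, D x -> E x) -> s <= t -> outer N E s -> outer N D t.
Proof.
  intros HDE Hst (lo & hi & Hc & Hs); exists lo, hi; split; [auto|].
  intros K; apply Rle_trans with s; auto.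
Qed.

Lemma null_mono N (D E : pt -> Prop) :
  (forall x, D x -> E x) -> null N E -> null N D.
Proof. intros H HE eps He; apply (outer_mono N D E eps eps); auto; lra. Qed.

Lemma bvol_degenerate N x : (1 <= N)%nat -> bvol N x x = 0.
Proof.
  intros HN; unfold bvol; rewrite (prodR_ext _ _ (fun _ => 0)).
  - rewrite prodR_const, pow_i; auto; lia.
  - intros; rewrite Rmax_left; lra.
Qed.

Lemma outer_box N lo hi : (1 <= N)%nat ->
  outer N (fun x => forall i, (i < N)%nat -> lo i <= x i <= hi i) (bvol N lo hi).
Proof.
  intros HN.
  exists (fun k => match k with O => lo | _ => lo end),
         (fun k => match k with O => hi | _ => lo end); split.
  - intros x Hx; now exists 0%nat.
  - intros K; destruct K as [|K]; [simpl; apply bvol_nonneg|].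
    rewrite sumR_succ_l.
    rewrite (sumR_ext _ _ (fun _ => 0)), sumR_const; [lra|].
    intros; now apply bvol_degenerate.
Qed.

Lemma outer_empty N (D : pt -> Prop) s : (1 <= N)%nat -> 0 <= s ->
  (forall x, ~ D x) -> outer N D s.
Proof.
  intros HN Hs HD.
  apply outer_mono with (3 := outer_box N (fun _ => 0) (fun _ => 0) HN).
  - intros x Hx; now destruct (HD x).
  - now rewrite bvol_degenerate.
Qed.

(** * Countable and finite subadditivity, affine images *)

Definition lsum {A} (f : A -> R) (l : list A) : R :=
  fold_right (fun a s => f a + s) 0 l.

Lemma lsum_app {A} (f : A -> R) l l' : lsum f (l ++ l') = lsum f l + lsum f l'.
Proof. induction l as [|a l IH]; simpl; [lra|]; rewrite IH; lra. Qed.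

Lemma lsum_incl {A} (f : A -> R) l l' :
  (forall a, 0 <= f a) -> NoDup l -> incl l l' -> lsum f l <= lsum f l'.
Proof.
  intros Hf Hl; revert l'; induction Hl as [|a l Ha Hl IH]; intros l' Hi; simpl.
  - induction l' as [|b l' IH']; simpl; [lra|].
    pose proof (Hf b). pose proof (IH' ltac:(intros x [])). lra.
  - destruct (in_split a l') as (l1 & l2 & ->); [apply Hi; now left|].
    assert (H : lsum f l <= lsum f (l1 ++ l2)).
    { apply IH; intros b Hb.
      assert (Hb' : In b (l1 ++ a :: l2)) by (apply Hi; now right).
      apply in_app_or in Hb'; apply in_or_app; simpl in Hb'.
      destruct Hb' as [|[->|]]; tauto. }
    rewrite lsum_app in *; simpl; lra.
Qed.

Lemma lsum_map_seq {A} (f : A -> R) (g : nat -> A) K :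
  lsum f (map g (seq 0 K)) = sumR K (fun k => f (g k)).
Proof.
  induction K as [|K IH]; auto.
  rewrite seq_S, map_app, lsum_app, IH; simpl; lra.
Qed.

Lemma lsum_list_prod (f : nat * nat -> R) l K :
  lsum f (list_prod l (seq 0 K)) = lsum (fun a => sumR K (fun b => f (a, b))) l.
Proof.
  induction l as [|a l IH]; simpl; auto.
  rewrite lsum_app, IH, lsum_map_seq; auto.
Qed.

(** The components of a pair never exceed its Cantor code, so the first [K] codes give distinct
    pairs in a square of side [K]. *)
Lemma sumR_cantor (f : nat -> nat -> R) K : (forall i j, 0 <= f i j) ->
  sumR K (fun t => f (fst (of_nat t)) (snd (of_nat t)))
  <= sumR K (fun i => sumR K (f i)).
Proof.
  intros Hf.
  set (g := fun c : nat * nat => f (fst c) (snd c)).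
  change (sumR K (fun t => g (of_nat t)) <= sumR K (fun i => sumR K (f i))).
  rewrite <- lsum_map_seq.
  apply Rle_trans with (lsum g (list_prod (seq 0 K) (seq 0 K))).
  - apply lsum_incl.
    + intros; apply Hf.
    + apply Injective_map_NoDup; [|apply seq_NoDup].
      intros a b H; now rewrite <- (cancel_to_of a), <- (cancel_to_of b), H.
    + intros [a b] H; apply in_map_iff in H as (t & Ht & Hin).
      apply in_seq in Hin.
      pose proof (to_nat_non_decreasing a b) as Hd.
      rewrite <- Ht, cancel_to_of in Hd.
      apply in_prod; apply in_seq; lia.
  - rewrite lsum_list_prod.
    pose proof (lsum_map_seq (fun a => sumR K (f a)) (fun i => i) K) as E.
    rewrite map_id in E; right; exact E.
Qed.

Lemma outer_bigcup N (D : nat -> pt -> Prop) (s : nat -> R) t :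
  (forall k, outer N (D k) (s k)) -> (forall K, sumR K s <= t) ->
  outer N (fun x => exists k, D k x) t.
Proof.
  intros HD Ht.
  destruct (functional_choice _ HD) as [lo HD1].
  destruct (functional_choice _ HD1) as [hi H].
  exists (fun u => lo (fst (of_nat u)) (snd (of_nat u))),
         (fun u => hi (fst (of_nat u)) (snd (of_nat u))); split.
  - intros x [k Hx]; destruct (H k) as [Hc _].
    destruct (Hc x Hx) as [j Hj]; exists (to_nat (k, j)).
    rewrite cancel_of_to; auto.
  - intros K.
    apply Rle_trans with (2 := Ht K).
    eapply Rle_trans.
    + apply (sumR_cantor (fun k j => bvol N (lo k j) (hi k j))).
      intros; apply bvol_nonneg.
    + apply sumR_le; intros k _; apply H.
Qed.

Lemma outer_union N (D E : pt -> Prop) s t : (1 <= N)%nat ->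
  outer N D s -> outer N E t -> outer N (fun x => D x \/ E x) (s + t).
Proof.
  intros HN HD HE.
  pose proof (outer_nonneg _ _ _ HD); pose proof (outer_nonneg _ _ _ HE).
  apply outer_mono with (s := s + t)
    (E := fun x => exists k : nat, match k with O => D x | S O => E x | _ => False end);
    [|lra|].
  - intros x [Hx|Hx]; [now exists 0%nat | now exists 1%nat].
  - apply outer_bigcup with
      (D := fun k x => match k with O => D x | S O => E x | _ => False end)
      (s := fun k => match k with O => s | S O => t | _ => 0 end).
    + intros [|[|k]]; auto; apply outer_empty; auto; lra.
    + intros [|[|K]]; [simpl; lra | simpl; lra |].
      rewrite !sumR_succ_l, sumR_const; lra.
Qed.

Lemma outer_finite_union N (D : nat -> pt -> Prop) (s : nat -> R) K : (1 <= N)%nat ->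
  (forall k, (k < K)%nat -> outer N (D k) (s k)) ->
  outer N (fun x => exists k, (k < K)%nat /\ D k x) (sumR K s).
Proof.
  intros HN; induction K as [|K IH]; intros H.
  - apply outer_empty; auto; [simpl; lra|]; intros x (k & Hk & _); lia.
  - apply outer_mono with (s := sumR K s + s K)
      (E := fun x => (exists k, (k < K)%nat /\ D k x) \/ D K x); [|simpl; lra|].
    + intros x (k & Hk & Hx); destruct (Nat.eq_dec k K) as [->|]; [tauto|].
      left; exists k; split; auto; lia.
    + apply outer_union; auto.
Qed.

Lemma null_bigcup N (D : nat -> pt -> Prop) :
  (forall k, null N (D k)) -> null N (fun x => exists k, D k x).
Proof.
  intros H eps He.
  apply outer_bigcup with (s := fun k => eps * (1/2)^(S k)).
  - intros k; apply H; apply Rmult_lt_0_compat; auto; apply pow_lt; lra.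
  - intros K; apply sumR_geometric; lra.
Qed.

Lemma outer_affine N D s c t : 0 < c -> outer N D s ->
  outer N (fun x => D (fun i => c * x i + t i)) (s / c ^ N).
Proof.
  intros Hc (lo & hi & Hcov & Hs).
  pose proof (Rinv_0_lt_compat _ Hc) as Hi.
  exists (fun k i => (lo k i - t i) / c), (fun k i => (hi k i - t i) / c); split.
  - intros x Hx; destruct (Hcov _ Hx) as [k Hk]; exists k; intros i Hlt.
    pose proof (Hk i Hlt) as Hk'; simpl in Hk'.
    split; [apply Rmult_le_reg_l with c | apply Rmult_le_reg_l with c]; auto;
      field_simplify; lra.
  - intros K.
    rewrite (sumR_ext _ _ (fun k => (/ c) ^ N * bvol N (lo k) (hi k))).
    + rewrite sumR_scal, pow_inv; unfold Rdiv; rewrite (Rmult_comm s).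
      apply Rmult_le_compat_l; auto.
      left; apply Rinv_0_lt_compat, pow_lt; auto.
    + intros k _; unfold bvol; rewrite <- prodR_const, <- prodR_mul.
      apply prodR_ext; intros i _.
      replace ((hi k i - t i) / c - (lo k i - t i) / c)
        with (/ c * (hi k i - lo k i)) by (field; lra).
      rewrite <- RmaxRmult by lra; f_equal; ring.
Qed.

Lemma null_affine N D c t : 0 < c -> null N D ->
  null N (fun x => D (fun i => c * x i + t i)).
Proof.
  intros Hc HD eps He.
  replace eps with (eps * c ^ N / c ^ N) by (field; apply pow_nonzero; lra).
  apply outer_affine; auto; apply HD.
  apply Rmult_lt_0_compat; auto; now apply pow_lt.
Qed.

(** Peel off one coordinate at a time. Points whose first bad coordinate is [j] lie in two slabs,
    below and above the cube, of total volume [l^j (L - l) L^(N-1-j)]; these volumes telescope. *)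
Lemma outer_box_minus_cube N lo u L l : (1 <= N)%nat -> 0 <= l ->
  (forall i, (i < N)%nat -> lo i <= u i /\ u i + l <= lo i + L) ->
  outer N (fun x => (forall i, (i < N)%nat -> lo i <= x i <= lo i + L) /\
                    exists i, (i < N)%nat /\ ~ (u i <= x i <= u i + l))
        (L ^ N - l ^ N).
Proof.
  intros HN Hl Hu.
  assert (HL : l <= L) by (pose proof (Hu 0%nat ltac:(lia)); lra).
  assert (Hpiece : forall j w a b, (j < N)%nat -> 0 <= w -> b j - a j = w ->
     (forall i, (i < N)%nat -> (i < j)%nat -> a i = u i /\ b i = u i + l) ->
     (forall i, (i < N)%nat -> (j < i)%nat -> a i = lo i /\ b i = lo i + L) ->
     bvol N a b = l ^ j * w * L ^ (N - S j)).
  { intros j w a b Hj Hw Hab H1 H2; unfold bvol.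
    replace N with (j + S (N - S j))%nat at 1 by lia.
    rewrite prodR_app.
    rewrite (prodR_ext j _ (fun _ => l)).
    2:{ intros i Hi; destruct (H1 i ltac:(lia) Hi) as [-> ->].
        rewrite Rmax_right; lra. }
    replace (S (N - S j)) with (1 + (N - S j))%nat by lia.
    rewrite prodR_app, !prodR_const.
    rewrite (prodR_ext (N - S j) _ (fun _ => L)).
    2:{ intros i Hi; destruct (H2 (j + (1 + i))%nat ltac:(lia) ltac:(lia)) as [-> ->].
        rewrite Rmax_right; lra. }
    rewrite prodR_const; simpl; rewrite Nat.add_0_r, Hab, Rmax_right by lra; ring. }
  assert (H : forall j, (j <= N)%nat ->
    outer N (fun x => (forall i, (i < N)%nat -> lo i <= x i <= lo i + L) /\
                    exists i, (i < j)%nat /\ ~ (u i <= x i <= u i + l))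
        (L ^ N - l ^ j * L ^ (N - j))).
  2:{ generalize (H N (le_n N)); rewrite Nat.sub_diag.
      apply outer_mono; [auto|simpl; lra]. }
  induction j as [|j IH]; intros Hj.
  - apply outer_empty; auto; [rewrite Nat.sub_0_r; simpl; lra|].
    intros x (_ & i & Hi & _); lia.
  - set (a := fun i => if (i <? j)%nat then u i else lo i).
    set (b := fun i => if (i <? j)%nat then u i + l else if (i =? j)%nat then u i else lo i + L).
    set (a' := fun i => if (i <? j)%nat then u i else if (i =? j)%nat then u i + l else lo i).
    set (b' := fun i => if (i <? j)%nat then u i + l else lo i + L).
    pose proof (Hu j ltac:(lia)) as [Hu1 Hu2].
    assert (Ev : bvol N a b = l ^ j * (u j - lo j) * L ^ (N - S j)).
    { apply Hpiece; [lia|lra|..]; unfold a, b.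
      - rewrite Nat.ltb_irrefl, Nat.eqb_refl; auto.
      - intros i _ Hi; apply Nat.ltb_lt in Hi as ->; auto.
      - intros i _ Hi; destruct (Nat.ltb_spec i j), (Nat.eqb_spec i j); try lia; auto. }
    assert (Ev' : bvol N a' b' = l ^ j * (lo j + L - (u j + l)) * L ^ (N - S j)).
    { apply Hpiece; [lia|lra|..]; unfold a', b'.
      - rewrite Nat.ltb_irrefl, Nat.eqb_refl; auto.
      - intros i _ Hi; apply Nat.ltb_lt in Hi as ->; auto.
      - intros i _ Hi; destruct (Nat.ltb_spec i j), (Nat.eqb_spec i j); try lia; auto. }
    apply outer_mono with (s := (L ^ N - l ^ j * L ^ (N - j)) + (bvol N a b + bvol N a' b'))
      (E := fun x => ((forall i, (i < N)%nat -> lo i <= x i <= lo i + L) /\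
                    exists i, (i < j)%nat /\ ~ (u i <= x i <= u i + l)) \/
         ((forall i, (i < N)%nat -> a i <= x i <= b i) \/
          (forall i, (i < N)%nat -> a' i <= x i <= b' i))).
    + intros x [Hx (i & Hi & Hn)].
      destruct (classic (exists i, (i < j)%nat /\ ~ (u i <= x i <= u i + l)))
        as [He|He]; [now left|right].
      assert (Hin : forall i, (i < j)%nat -> u i <= x i <= u i + l).
      { intros i' Hi'; destruct (classic (u i' <= x i' <= u i' + l)); auto.
        exfalso; apply He; eauto. }
      assert (i = j) as ->.
      { destruct (Nat.eq_dec i j); auto; exfalso; apply Hn, Hin; lia. }
      destruct (Rlt_le_dec (x j) (u j)) as [Hlt|Hge]; [left|right];
        intros i Hi'; unfold a, b, a', b'; pose proof (Hx i Hi');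
        destruct (Nat.ltb_spec i j); auto;
        destruct (Nat.eqb_spec i j) as [->|]; lra.
    + rewrite Ev, Ev'; replace (N - j)%nat with (S (N - S j)) by lia; simpl.
      right; ring.
    + apply outer_union; [auto | apply IH; lia | apply outer_union; auto using outer_box].
Qed.

(** * Density along grids *)

(** Half-open, so that the cells partition space. The offset [o] is in units of the mesh, which
    suits grids pulled back along an affine map. *)
Definition cell (N : nat) (d : R) (o : pt) (a : nat -> Z) (x : pt) : Prop :=
  forall i, (i < N)%nat -> d * (IZR (a i) + o i) <= x i < d * (IZR (a i) + o i + 1).

(** Coordinates are freed from their cell one by one: a side of length [len] meets at most
    [len / d + 2] grid intervals, which yields the factor [len + 2 * d]. *)
Lemma outer_box_of_cells N D th d o lo hi : (1 <= N)%nat -> 0 < d -> 0 <= th ->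
  (forall a, outer N (fun x => D x /\ cell N d o a x) (th * d ^ N)) ->
  outer N (fun x => D x /\ forall i, (i < N)%nat -> lo i <= x i <= hi i)
        (th * prodR N (fun i => Rmax 0 (hi i - lo i) + 2 * d)).
Proof.
  intros HN Hd Hth H.
  set (f := fun i => Rmax 0 (hi i - lo i) + 2 * d).
  assert (Hf : forall i, 0 <= f i)
    by (intros i; unfold f; pose proof (Rmax_l 0 (hi i - lo i)); lra).
  assert (G : forall j, (j <= N)%nat -> forall a,
    outer N (fun x => D x /\ forall i, (i < N)%nat ->
       ((i < j)%nat -> lo i <= x i <= hi i) /\
       ((j <= i)%nat -> d * (IZR (a i) + o i) <= x i < d * (IZR (a i) + o i + 1)))
      (th * (prodR j f * d ^ (N - j)))).
  2:{ generalize (G N (le_n N) (fun _ => 0%Z)); rewrite Nat.sub_diag.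
      apply outer_mono; [|simpl; lra].
      intros x [Hx Hb]; split; auto; intros i Hi; split; auto; lia. }
  induction j as [|j IH]; intros Hj a.
  - generalize (H a); rewrite Nat.sub_0_r; simpl.
    apply outer_mono; [|lra].
    intros x [Hx Hc]; split; auto; intros i Hi; apply Hc; auto; lia.
  - set (len := Rmax 0 (hi j - lo j)).
    set (K := Z.to_nat (up (len / d + 1))).
    destruct (archimed (len / d + 1)) as [Hu1 Hu2].
    assert (Hlen : 0 <= len / d) 
      by (apply Rmult_le_pos; [apply Rmax_l | left; now apply Rinv_0_lt_compat]).
    assert (HKZ : INR K = IZR (up (len / d + 1))).
    { unfold K; rewrite INR_IZR_INZ, Z2Nat.id; auto.
      apply le_IZR; lra. }
    assert (HKd : INR K * d <= f j).
    { unfold f; fold len.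
      replace (len + 2 * d) with ((len / d + 2) * d) by (field; lra).
      apply Rmult_le_compat_r; lra. }
    set (z0 := Zfloor (lo j / d - o j)).
    set (a' := fun k i => if (i =? j)%nat then (z0 + Z.of_nat k)%Z else a i).
    apply outer_mono with
      (s := sumR K (fun _ => th * (prodR j f * d ^ (N - j))))
      (E := fun x => exists k, (k < K)%nat /\ (D x /\ forall i, (i < N)%nat ->
       ((i < j)%nat -> lo i <= x i <= hi i) /\
       ((j <= i)%nat -> d * (IZR (a' k i) + o i) <= x i < d * (IZR (a' k i) + o i + 1)))).
    + intros x [Hx Hc].
      set (z := Zfloor (x j / d - o j)).
      pose proof (proj1 (Hc j ltac:(lia)) ltac:(lia)) as Hxj.
      assert (Hle : lo j / d <= x j / d).
      { apply Rmult_le_compat_r; [left; now apply Rinv_0_lt_compat|lra]. }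
      assert (Hz : (z0 <= z)%Z) by (apply Zfloor_le; lra).
      pose proof (Zfloor_bound (lo j / d - o j)) as Hb0; fold z0 in Hb0.
      pose proof (Zfloor_bound (x j / d - o j)) as Hb; fold z in Hb.
      assert (Hdif : x j / d - lo j / d <= len / d).
      { unfold len; replace (x j / d - lo j / d) with ((x j - lo j) / d) by (field; lra).
        apply Rmult_le_compat_r; [left; now apply Rinv_0_lt_compat|].
        rewrite Rmax_right; lra. }
      exists (Z.to_nat (z - z0)); split.
      { apply INR_lt; rewrite HKZ, INR_IZR_INZ, Z2Nat.id by lia.
        rewrite minus_IZR; lra. }
      split; auto; intros i Hi; split.
      * intros Hij; apply (Hc i Hi); lia.
      * intros Hij; unfold a'; destruct (Nat.eqb_spec i j) as [->|].
        -- rewrite Z2Nat.id by lia.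
           replace (z0 + (z - z0))%Z with z by lia.
           split; [apply Rmult_le_reg_l with (/ d) | apply Rmult_lt_reg_l with (/ d)];
             try (now apply Rinv_0_lt_compat);
             rewrite <- Rmult_assoc, Rinv_l, Rmult_1_l by lra;
             rewrite (Rmult_comm (/ d)); unfold Rdiv in *; lra.
        -- apply (Hc i Hi); lia.
    + rewrite sumR_const.
      pose proof (prodR_nonneg j f ltac:(auto)).
      replace (N - j)%nat with (S (N - S j)) by lia; simpl.
      pose proof (pow_le d (N - S j) ltac:(lra)).
      apply Rle_trans with (th * (prodR j f * d ^ (N - S j)) * (INR K * d)); [right; ring|].
      apply Rle_trans with (th * (prodR j f * d ^ (N - S j)) * f j); [|right; ring].
      apply Rmult_le_compat_l; auto.
      repeat apply Rmult_le_pos; auto.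
    + apply outer_finite_union; auto; intros k _; apply IH; lia.
Qed.

(* Refining any cover by the grid gains a factor [th]; iterating gives measure zero. *)
Lemma null_of_cells N D th s0 : (1 <= N)%nat -> 0 <= th < 1 -> outer N D s0 ->
  (forall eta, 0 < eta -> exists d o, 0 < d < eta /\
     forall a, outer N (fun x => D x /\ cell N d o a x) (th * d ^ N)) ->
  null N D.
Proof.
  intros HN Hth H0 H.
  assert (Step : forall s eps, 0 < eps -> outer N D s -> outer N D (th * s + eps)).
  { intros s eps He (lo & hi & Hc & Hs).
    apply outer_mono with (s := th * s + eps)
      (E := fun x => exists k, D x /\ forall i, (i < N)%nat -> lo k i <= x i <= hi k i);
      [|lra|].
    - intros x Hx; destruct (Hc x Hx) as [k Hk]; now exists k.
    - apply outer_bigcup with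
        (D := fun k x => D x /\ forall i, (i < N)%nat -> lo k i <= x i <= hi k i)
        (s := fun k => th * bvol N (lo k) (hi k) + eps * (1/2)^(S k)).
      + intros k.
        assert (Hek : 0 < eps * (1/2)^(S k))
          by (apply Rmult_lt_0_compat; auto; apply pow_lt; lra).
        (* The mesh is chosen separately for each box of the cover, so boxes of arbitrarily small or
           unequal sides cause no trouble. *)
        destruct (prodR_perturb N (fun i => Rmax 0 (hi k i - lo k i)) _
          ltac:(intros; apply Rmax_l) Hek) as (eta & Heta & Hp).
        destruct (H eta Heta) as (d & o & Hd & Hcell).
        eapply outer_mono; [| |apply (outer_box_of_cells N D th d o (lo k) (hi k));
          auto; lra]; [auto|].
        pose proof (Hp d Hd) as Hp'; unfold bvol.
        apply Rle_trans with (th * (prodR N (fun i => Rmax 0 (hi k i - lo k i)) +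
          eps * (1 / 2) ^ S k)); [apply Rmult_le_compat_l; lra|].
        rewrite Rmult_plus_distr_l; nra.
      + intros K; rewrite sumR_plus, sumR_scal.
        pose proof (sumR_geometric K eps ltac:(lra)).
        pose proof (Rmult_le_compat_l th _ _ ltac:(lra) (Hs K)); lra. }
  pose proof (outer_nonneg _ _ _ H0) as Hs0.
  assert (Iter : forall n eps, 0 < eps -> outer N D (th ^ n * s0 + eps)).
  { induction n as [|n IH]; intros eps He.
    - apply outer_mono with (3 := H0); auto; simpl; lra.
    - apply outer_mono with (s := th * (th ^ n * s0 + eps / 2) + eps / 2) (E := D);
        auto; [simpl; nra|].
      apply Step; [lra|]; apply IH; lra. }
  intros eps He.
  destruct (pow_lt_1_zero th ltac:(rewrite Rabs_right; lra) (eps / (2 * (s0 + 1)))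
    ltac:(apply Rdiv_lt_0_compat; lra)) as [n Hn].
  specialize (Hn n (le_n n)).
  pose proof (pow_le th n ltac:(lra)).
  rewrite Rabs_right in Hn by lra.
  apply outer_mono with (s := th ^ n * s0 + eps / 2) (E := D); auto; [|apply Iter; lra].
  assert (eps / (2 * (s0 + 1)) * (s0 + 1) = eps / 2) by (field; lra).
  nra.
Qed.

(** * Porous sets are null *)

(* Stopping time in a binary tree of sets: stop at the first node satisfying [P]. *)
Fixpoint first_hit {node : Type} (child : bool -> node -> node)
  (set : node -> pt -> Prop) (P : node -> Prop) (j : nat) (n : node) (x : pt) : Prop :=
  match j with
  | O => P n /\ set n x
  | S j' => ~ P n /\ exists b, first_hit child set P j' (child b n) x
  end.

(** No stopping node lies below another, so by additivity of [vol] the volumes of the stopping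
    nodes, collected by depth in [mass], sum to at most [vol n] (a Kraft inequality), and the local
    bounds add up. *)
Lemma outer_first_hit {node : Type} N D (child : bool -> node -> node) set P vol th n :
  (1 <= N)%nat -> 0 <= th -> (forall n, 0 <= vol n) ->
  (forall n, vol n = vol (child false n) + vol (child true n)) ->
  (forall n, P n -> outer N (fun x => D x /\ set n x) (th * vol n)) ->
  outer N (fun x => D x /\ exists j, first_hit child set P j n x) (th * vol n).
Proof.
  intros HN Hth Hv Hsplit HP.
  set (ind := fun Q : Prop => if excluded_middle_informative Q then 1 else 0).
  set (mass := fix mass j n : R :=
    match j with
    | O => ind (P n) * vol n
    | S j' => ind (~ P n) * (mass j' (child false n) + mass j' (child true n))
    end).
  assert (Hmass : forall J n, 0 <= sumR J (fun j => mass j n) <= vol n).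
  { induction J as [|J IH]; intros n'; [simpl; split; [lra|apply Hv]|].
    rewrite sumR_succ_l.
    rewrite (sumR_ext J _ (fun j => ind (~ P n') *
       (mass j (child false n') + mass j (child true n')))) by reflexivity.
    rewrite sumR_scal, sumR_plus.
    pose proof (IH (child false n')); pose proof (IH (child true n')).
    pose proof (Hsplit n'); pose proof (Hv n').
    simpl; unfold ind.
    destruct (excluded_middle_informative (P n')),
      (excluded_middle_informative (~ P n')); try tauto; lra. }
  assert (Hmass0 : forall j n, 0 <= mass j n).
  { induction j as [|j IH]; intros n'; simpl; unfold ind.
    - destruct excluded_middle_informative; pose proof (Hv n'); lra.
    - destruct excluded_middle_informative;
      pose proof (IH (child false n')); pose proof (IH (child true n')); lra. }
  assert (Hhit : forall j n, outer N (fun x => D x /\ first_hit child set P j n x) (th * mass j n)).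
  { induction j as [|j IH]; intros n'; simpl; unfold ind.
    - destruct (excluded_middle_informative (P n')) as [p|p].
      + apply outer_mono with (3 := HP n' p); [tauto | lra].
      + apply outer_empty; auto; [lra|tauto].
    - destruct (excluded_middle_informative (~ P n')) as [p|p].
      + apply outer_mono with (3 := outer_union N _ _ _ _ HN
          (IH (child false n')) (IH (child true n'))); [|right; ring].
        intros x (Hx & _ & [|] & H); tauto.
      + apply outer_empty; auto; [lra|tauto]. }
  apply outer_mono with (s := th * vol n)
    (E := fun x => exists j, D x /\ first_hit child set P j n x); [|lra|].
  - intros x (Hx & j & Hj); now exists j.
  - apply outer_bigcup with (D := fun j x => D x /\ first_hit child set P j n x)
      (s := fun j => th * mass j n); auto.
    intros K; rewrite sumR_scal; apply Rmult_le_compat_l; auto; apply Hmass.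
Qed.

(* Dyadic boxes are bisected along one coordinate at a time, cyclically:
   [level N t i] is the number of bisections of coordinate [i] up to time [t]. *)
Fixpoint level (N t i : nat) : nat :=
  match t with
  | O => O
  | S t' => level N t' i + (if (i =? t' mod N)%nat then 1 else 0)
  end.

Definition dyadic_set (N : nat) (n : nat * (nat -> Z)) (x : pt) : Prop :=
  forall i, (i < N)%nat ->
    IZR (snd n i) <= 2 ^ level N (fst n) i * x i < IZR (snd n i) + 1.

Definition dyadic_child (N : nat) (b : bool) (n : nat * (nat -> Z)) : nat * (nat -> Z) :=
  (S (fst n), fun i => if (i =? fst n mod N)%nat
                       then (2 * snd n i + Z.b2z b)%Z else snd n i).

(** After [k] full rounds every coordinate has been bisected [k] times: the nodes at depth [k * N]
    are cubes. *)
Lemma level_mul N k i : (i < N)%nat -> level N (k * N) i = k.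
Proof.
  intros Hi.
  assert (H : forall k r, (r <= N)%nat ->
    level N (k * N + r) i = (level N (k * N) i + if (i <? r)%nat then 1 else 0)%nat).
  { clear k; intros k; induction r as [|r IH]; intros Hr.
    - rewrite Nat.add_0_r; simpl; lia.
    - rewrite Nat.add_succ_r; simpl; rewrite IH by lia.
      rewrite Nat.add_comm with (n := (k * N)%nat), Nat.Div0.mod_add, Nat.mod_small by lia.
      destruct (Nat.ltb_spec i r), (Nat.ltb_spec i (S r)), (Nat.eqb_spec i r); lia. }
  induction k as [|k IH]; auto.
  replace (S k * N)%nat with (k * N + N)%nat by lia.
  rewrite H, IH by lia.
  apply Nat.ltb_lt in Hi as ->; lia.
Qed.

Lemma dyadic_set_child N n x : (1 <= N)%nat -> dyadic_set N n x ->
  exists b, dyadic_set N (dyadic_child N b n) x.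
Proof.
  intros HN Hx; destruct n as [t a]; unfold dyadic_set, dyadic_child in *; cbn [fst snd level] in *.
  set (i0 := (t mod N)%nat).
  assert (Hi0 : (i0 < N)%nat) by (apply Nat.mod_upper_bound; lia).
  pose proof (Hx i0 Hi0) as H0.
  exists (if Rlt_dec (2 * (2 ^ level N t i0 * x i0)) (2 * IZR (a i0) + 1) then false else true).
  intros i Hi; rewrite pow_add.
  destruct (Nat.eqb_spec i i0) as [->|Hn].
  - destruct Rlt_dec; rewrite plus_IZR, mult_IZR; simpl; lra.
  - pose proof (Hx i Hi); simpl; lra.
Qed.

Lemma dyadic_set_cell N k a x : dyadic_set N (k * N, a)%nat x <->
  cell N ((1/2) ^ k) (fun _ => 0) a x.
Proof.
  assert (H2 : 0 < (1/2)^k) by (apply pow_lt; lra).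
  assert (H : (1/2)^k * 2^k = 1)
    by (rewrite <- Rpow_mult_distr; replace (1/2*2) with 1 by field; apply pow1).
  unfold dyadic_set, cell; simpl; split; intros Hx i Hi; specialize (Hx i Hi);
    rewrite level_mul in * by auto.
  - replace (x i) with ((1/2)^k * (2^k * x i)) by (rewrite <- Rmult_assoc, H; ring).
    split; [apply Rmult_le_compat_l | apply Rmult_lt_compat_l]; lra.
  - replace (x i) with ((1/2)^k * (2^k * x i)) in Hx by (rewrite <- Rmult_assoc, H; ring).
    split; [apply Rmult_le_reg_l with ((1/2)^k) | apply Rmult_lt_reg_l with ((1/2)^k)]; lra.
Qed.

(** A Vitali argument in which the good scale may depend on the point. Inside a cell of one fixed
    grid, stopping at the first node of low density merges all these scales into the uniform bound
    required by [null_of_cells]. *)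
Lemma null_dyadic N D th s0 : (1 <= N)%nat -> 0 <= th < 1 -> outer N D s0 ->
  (forall x, D x -> forall k0, exists k a, (k0 <= k)%nat /\
     cell N ((1/2) ^ k) (fun _ => 0) a x /\
     outer N (fun y => D y /\ cell N ((1/2) ^ k) (fun _ => 0) a y) (th * ((1/2) ^ k) ^ N)) ->
  null N D.
Proof.
  intros HN Hth H0 HD.
  apply null_of_cells with th s0; auto.
  intros eta Heta.
  destruct (pow_lt_1_zero (1/2) ltac:(rewrite Rabs_right; lra) eta Heta) as [k0 Hk0].
  specialize (Hk0 k0 (le_n k0)).
  assert (Hp : 0 < (1/2)^k0) by (apply pow_lt; lra).
  rewrite Rabs_right in Hk0 by lra.
  exists ((1/2)^k0), (fun _ => 0); split; [lra|]; intros a.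
  set (vol := fun n : nat * (nat -> Z) => (1/2) ^ fst n).
  set (P := fun n => outer N (fun x => D x /\ dyadic_set N n x) (th * vol n)).
  assert (Hvol : forall k b, vol (k * N, b)%nat = ((1/2)^k)^N)
    by (intros; unfold vol; simpl; now rewrite pow_mult).
  rewrite <- (Hvol k0 a).
  apply outer_mono with (s := th * vol (k0 * N, a)%nat)
    (E := fun x => D x /\ exists j,
       first_hit (dyadic_child N) (dyadic_set N) P j (k0 * N, a)%nat x); [|lra|].
  - intros x [Hx Hc]; split; auto.
    destruct (HD x Hx k0) as (k & b & Hk & Hb & HP).
    (* Descend along the nodes containing [x]. At depth [k * N] the node has the same first [N]
       coordinates as the cell [b], so [P] holds there at the latest. *)
    assert (Hstop : forall d n, (fst n + d = k * N)%nat -> dyadic_set N n x ->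
      exists j, first_hit (dyadic_child N) (dyadic_set N) P j n x).
    { induction d as [|d IH]; intros n Hn Hset;
      (destruct (classic (P n)) as [p|p]; [exists 0%nat; now split|]).
      - exfalso; apply p; unfold P.
        destruct n as [t c]; simpl in Hn; rewrite Nat.add_0_r in Hn; subst t.
        rewrite Hvol; apply outer_mono with (3 := HP); [|lra].
        intros y [Hy Hyc]; split; auto; apply dyadic_set_cell in Hyc.
        assert (Ecb : forall i, (i < N)%nat -> c i = b i).
        { intros i Hi.
          apply dyadic_set_cell in Hb; specialize (Hb i Hi); specialize (Hset i Hi).
          simpl in *.
          now rewrite <- (Zfloor_eq _ _ Hb), <- (Zfloor_eq _ _ Hset). }
        intros i Hi; rewrite <- Ecb by auto; now apply Hyc.
      - destruct (dyadic_set_child N n x HN Hset) as [c Hc'].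
        destruct (IH (dyadic_child N c n)) as [j Hj]; auto; [simpl; lia|].
        exists (S j); simpl; split; eauto. }
    apply Hstop with (d := (k * N - k0 * N)%nat); [simpl; nia|].
    now apply dyadic_set_cell.
  - apply outer_first_hit; auto; try lra.
    + intros n; apply pow_le; lra.
    + intros n; unfold vol; simpl; lra.
Qed.

(* An interval shorter than a third of the mesh avoids the nodes of the dyadic grid
   or those of its translate by [1/3]. *)
Lemma one_third_trick k x r : 0 <= r -> 6 * r < (1/2) ^ k ->
  exists (b : bool) (z : Z), let t := if b then 1/3 else 0 in
    (1/2)^k * IZR z <= x - t - r /\ x - t + r < (1/2)^k * (IZR z + 1).
Proof.
  intros Hr H; set (d := (1/2)^k) in *.
  assert (Hd : 0 < d) by lra.
  assert (Hfl : forall y, d * IZR (Zfloor (y / d)) <= y < d * (IZR (Zfloor (y / d)) + 1)).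
  { intros y; pose proof (Zfloor_bound (y / d)) as [H1 H2].
    replace y with (d * (y / d)) at 2 3 by (field; lra).
    split; [apply Rmult_le_compat_l | apply Rmult_lt_compat_l]; lra. }
  set (z0 := Zfloor ((x - r) / d)); set (z1 := Zfloor ((x - 1/3 - r) / d)).
  pose proof (Hfl (x - r)) as H0; pose proof (Hfl (x - 1/3 - r)) as H1.
  fold z0 in H0; fold z1 in H1.
  destruct (Rlt_le_dec (x + r) (d * (IZR z0 + 1))) as [Hl0|Hg0].
  { exists false, z0; simpl; lra. }
  destruct (Rlt_le_dec (x - 1/3 + r) (d * (IZR z1 + 1))) as [Hl1|Hg1].
  { exists true, z1; simpl; lra. }
  exfalso.
  (* Both grids now have a node within [r] of [x]. Their distance, times [3 / d], is the absolute
     value of an integer below 1; hence it is 0 and 3 divides a power of 2. *)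
  assert (Hab : -d < d * (3 * (IZR z1 - IZR z0)) + 1 < d) by lra.
  assert (E1 : d * IZR (2 ^ Z.of_nat k) = 1).
  { rewrite <- pow_IZR; unfold d; rewrite <- Rpow_mult_distr.
    replace (1/2*2) with 1 by field; apply pow1. }
  assert (Hz : (-1 < 3 * (z1 - z0) + 2 ^ Z.of_nat k < 1)%Z).
  { split; apply lt_IZR; rewrite plus_IZR, mult_IZR, minus_IZR;
      apply Rmult_lt_reg_l with d; auto; lra. }
  assert (H3 : (3 | 2 ^ Z.of_nat k)%Z) by (exists (z0 - z1)%Z; lia).
  clear - H3; induction k as [|k IH].
  - destruct H3 as [c Hc]; simpl in Hc; lia.
  - rewrite Nat2Z.inj_succ, Z.pow_succ_r in H3 by lia.
    apply prime_mult in H3 as [[c Hc]|H3]; auto; [lia | apply prime_3].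
Qed.

Lemma pigeonhole (T : nat) (Q : nat -> nat -> Prop) :
  (forall k0, exists k, (k0 <= k)%nat /\ exists t, (t < T)%nat /\ Q t k) ->
  exists t, (t < T)%nat /\ forall k0, exists k, (k0 <= k)%nat /\ Q t k.
Proof.
  intros H; apply NNPP; intros Hn.
  assert (Hb : forall T', (T' <= T)%nat ->
    exists k0, forall t k, (t < T')%nat -> (k0 <= k)%nat -> ~ Q t k).
  { induction T' as [|T' IH]; intros HT; [exists 0%nat; lia|].
    destruct IH as [k0 Hk0]; [lia|].
    destruct (classic (forall k1, exists k, (k1 <= k)%nat /\ Q T' k)) as [Hi|Hi].
    { exfalso; apply Hn; exists T'; auto. }
    apply not_all_ex_not in Hi as [k1 Hk1].
    exists (k0 + k1)%nat; intros t k Ht Hk HQ.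
    destruct (Nat.eq_dec t T') as [->|].
    - apply Hk1; exists k; split; auto; lia.
    - apply (Hk0 t k); auto; lia. }
  destruct (Hb T (le_n T)) as [k0 Hk0].
  destruct (H k0) as (k & Hk & t & Ht & HQ); eapply Hk0; eauto.
Qed.

(** Encodes the choice of a shift 0 or 1/3 in every coordinate by one of [2 ^ N] numbers, as
    [pigeonhole] requires. *)
Lemma testbit_interpolate N (b : nat -> bool) :
  exists t, (t < 2 ^ N)%nat /\ forall i, (i < N)%nat -> Nat.testbit t i = b i.
Proof.
  revert b; induction N as [|N IH]; intros b.
  - exists 0%nat; simpl; split; auto; lia.
  - destruct (IH (fun i => b (S i))) as (t & Ht & Hb).
    exists (2 * t + Nat.b2n (b 0%nat))%nat; split.
    + rewrite Nat.pow_succ_r'; destruct (b 0%nat); simpl; lia.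
    + intros [|i] Hi.
      * apply Nat.testbit_0_r.
      * rewrite Nat.testbit_succ_r; apply Hb; lia.
Qed.

Lemma dyadic_scale s k0 : 0 < s < (1/2) ^ k0 ->
  exists k, (k0 <= k)%nat /\ s < (1/2) ^ k <= 2 * s.
Proof.
  intros [Hs H0].
  destruct (pow_lt_1_zero (1/2) ltac:(rewrite Rabs_right; lra) s Hs) as [n Hn].
  specialize (Hn n (le_n n)).
  rewrite Rabs_right in Hn by (left; apply Rlt_gt, pow_lt; lra).
  induction n as [|n IH].
  - pose proof (pow_incr (1/2) 1 k0 ltac:(lra)) as Hk; rewrite pow1 in Hk; simpl in Hn; lra.
  - destruct (Rlt_le_dec ((1/2)^n) s) as [Hl|Hg]; [auto|].
    simpl in Hn.
    destruct (Rle_lt_or_eq_dec _ _ Hg) as [Hg'|He].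
    + exists n; split; [|lra].
      destruct (Nat.le_gt_cases k0 n) as [|Hlt]; auto.
      replace k0 with (n + 1 + (k0 - S n))%nat in H0 by lia.
      rewrite !pow_add in H0.
      pose proof (pow_incr (1/2) 1 (k0 - S n) ltac:(lra)) as Hk; rewrite pow1 in Hk.
      pose proof (pow_le (1/2) (k0 - S n) ltac:(lra)); simpl in H0; nra.
    + destruct n as [|n].
      { pose proof (pow_incr (1/2) 1 k0 ltac:(lra)) as Hk; rewrite pow1 in Hk; simpl in He; lra. }
      simpl in *; exists n; split; [|lra].
      destruct (Nat.le_gt_cases k0 n) as [|Hlt]; auto.
      replace k0 with (n + 1 + (k0 - S n))%nat in H0 by lia.
      rewrite !pow_add in H0.
      pose proof (pow_incr (1/2) 1 (k0 - S n) ltac:(lra)) as Hk; rewrite pow1 in Hk.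
      pose proof (pow_le (1/2) (k0 - S n) ltac:(lra)); simpl in H0; nra.
Qed.

(** A point and its hole fit into a common cell of comparable size, dyadic up to a shift by 1/3 in
    some coordinates, and the hole fills a fixed fraction of that cell. Some shift serves a given
    point at arbitrarily small scales; [D] is split by such shifts and [null_dyadic] treats each
    part. *)
Lemma null_porous N D c s0 : (1 <= N)%nat -> 0 <= c -> outer N D s0 ->
  (forall x, D x -> forall eps, 0 < eps -> exists rho y, 0 < rho < eps /\
     (forall i, (i < N)%nat -> Rabs (x i - y i) <= c * rho) /\
     (forall z, (forall i, (i < N)%nat -> Rabs (z i - y i) < rho) -> ~ D z)) ->
  null N D.
Proof.
  intros HN Hc H0 HD.
  (* The cube of radius [r = (c + 1) * rho] about [x] contains the hole, and the mesh [d] will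
     satisfy [6 * r < d <= 12 * r]; this [kap] gives [kap * d <= rho]. *)
  set (kap := / (12 * (c + 1))).
  assert (Hkap : 0 < kap) by (apply Rinv_0_lt_compat; lra).
  assert (Hkap' : kap * (12 * (c + 1)) = 1) by (unfold kap; field; lra).
  assert (Hkap1 : kap < 1) by nra.
  assert (HkapN : 0 < kap ^ N <= 1).
  { split; [now apply pow_lt|]; rewrite <- (pow1 N); apply pow_incr; lra. }
  set (sh := fun t i => if Nat.testbit t i then 1/3 else 0).
  set (good := fun t k x => exists a, cell N ((1/2)^k) (fun _ => 0) a (fun i => x i - sh t i) /\
     exists u : pt,
       (forall i, (i < N)%nat -> (1/2)^k * IZR (a i) <= u i /\
          u i + kap * (1/2)^k <= (1/2)^k * IZR (a i) + (1/2)^k) /\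
       (forall z, (forall i, (i < N)%nat -> u i <= z i - sh t i <= u i + kap * (1/2)^k) -> ~ D z)).
  set (part := fun t x => D x /\ forall k0, exists k, (k0 <= k)%nat /\ good t k x).
  assert (Hcover : forall x, D x -> exists t, part t x).
  { intros x Hx.
    destruct (pigeonhole (2 ^ N) (fun t k => good t k x)) as (t & _ & Ht);
      [|exists t; now split].
    intros k0.
    assert (Hk0 : 0 < (1/2)^k0) by (apply pow_lt; lra).
    destruct (HD x Hx ((1/2)^k0 / (6 * (c + 1)))) as (rho & y & Hrho & Hy & Hhole).
    { apply Rdiv_lt_0_compat; lra. }
    set (r := (c + 1) * rho).
    assert (Hr : 0 < r) by (apply Rmult_lt_0_compat; lra).
    assert (Hrk : 6 * r < (1/2)^k0).
    { replace ((1/2)^k0) with (6 * (c + 1) * ((1/2)^k0 / (6 * (c + 1)))) by (field; lra).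
      unfold r; nra. }
    destruct (dyadic_scale (6 * r) k0) as (k & Hk & Hk1 & Hk2); [lra|].
    exists k; split; auto.
    set (d := (1/2)^k) in *.
    assert (Hside : kap * d <= rho).
    { replace rho with (kap * (2 * (6 * r))); [apply Rmult_le_compat_l; lra|].
      unfold r; replace (kap * (2 * (6 * ((c + 1) * rho))))
        with ((kap * (12 * (c + 1))) * rho) by ring.
      rewrite Hkap'; ring. }
    destruct (functional_choice _ (fun i => one_third_trick k (x i) r ltac:(lra) Hk1))
      as [b Hb]; destruct (functional_choice _ Hb) as [a Ha]; fold d in Ha.
    destruct (testbit_interpolate N b) as (t & Ht & Hbt).
    exists t; split; auto.
    exists a; split.
    { intros i Hi; specialize (Ha i); unfold sh; rewrite (Hbt i Hi); fold d; simpl in Ha; lra. }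
    (* Lower corner, in shifted coordinates, of the cube of side [kap * d] centred at [y]. Its half
       side is at most [rho / 2], so it lies inside the open hole. *)
    exists (fun i => y i - sh t i - kap * d / 2); split.
    - intros i Hi; specialize (Ha i); unfold sh; rewrite (Hbt i Hi).
      pose proof (Hy i Hi) as Hyi.
      pose proof (Rle_abs (x i - y i)); pose proof (Rle_abs (- (x i - y i))) as Hm.
      rewrite Rabs_Ropp in Hm; simpl in Ha; fold d.
      unfold r in Ha; destruct (b i); nra.
    - intros z Hz; apply Hhole; intros i Hi; specialize (Hz i Hi); fold d in Hz.
      simpl in Hz; apply Rabs_def1; lra. }
  apply null_mono with (fun x => exists t, part t x); auto.
  apply null_bigcup; intros t.
  assert (Hshift : forall x : pt, (fun i => 1 * (1 * x i + - sh t i) + sh t i) = x)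
    by (intros; extensionality i; ring).
  assert (Hnull : null N (fun x => part t (fun i => 1 * x i + sh t i))).
  { apply null_dyadic with (1 - kap ^ N) (s0 / 1 ^ N); auto; [lra| |].
    - apply outer_affine with (D := part t); [lra|].
      apply outer_mono with (3 := H0); [intros x Hx; apply Hx | lra].
    - intros x [Hx Hk] k0; destruct (Hk k0) as (k & Hkk & a & Ha & u & Hu & Hhole).
      exists k, a; split; [auto|split].
      + intros i Hi; specialize (Ha i Hi); simpl in Ha; lra.
      + assert (Hd : 0 < (1/2)^k) by (apply pow_lt; lra).
        pose proof (outer_box_minus_cube N (fun i => (1/2)^k * IZR (a i)) u ((1/2)^k)
          (kap * (1/2)^k) HN ltac:(apply Rmult_le_pos; lra) Hu) as Ho.
        apply outer_mono with (3 := Ho).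
        * intros z [[Hz _] Hzc]; split.
          { intros i Hi; specialize (Hzc i Hi); lra. }
          apply NNPP; intros Hn; apply (Hhole (fun i => 1 * z i + sh t i)); auto.
          intros i Hi; destruct (classic (u i <= z i <= u i + kap * (1/2)^k)) as [Hin|Hin];
            [lra|exfalso; apply Hn; eauto].
        * rewrite Rpow_mult_distr; right; ring. }
  apply null_mono with (2 := null_affine N _ 1 (fun i => - sh t i) Rlt_0_1 Hnull).
  intros x Hx; simpl; now rewrite Hshift.
Qed.

(** * Equidistribution of periodic sets *)

Lemma sum_clip_le lo hi d L : 0 <= d ->
  sumR L (fun t => Rmax 0 (Rmin hi (INR t * d + d) - Rmax lo (INR t * d)))
  <= Rmax 0 (hi - lo).
Proof.
  intros Hd.
  apply Rle_trans with (Rmax 0 (Rmin hi (INR L * d) - lo)).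
  - induction L as [|L IH]; [apply Rmax_l|].
    rewrite sumR_succ, S_INR; revert IH.
    set (S0 := sumR _ _); set (X := INR L * d).
    replace ((INR L + 1) * d) with (X + d) by (unfold X; ring).
    unfold Rmax, Rmin; repeat destruct Rle_dec; lra.
  - unfold Rmax, Rmin; repeat destruct Rle_dec; lra.
Qed.

(** Averaging for infinite series: one [t] must work for all [K]. Monotonicity lets the failures of
    all [t] be gathered at a common [K], where the average is then exceeded. *)
Lemma exists_below_average L (f : nat -> nat -> R) s : (0 < L)%nat ->
  (forall t K K', (K <= K')%nat -> f t K <= f t K') ->
  (forall K, sumR L (fun t => f t K) <= s) ->
  exists t, (t < L)%nat /\ forall K, f t K <= s / INR L.
Proof.
  intros HL Hmon Hs; apply NNPP; intros Hn.
  assert (Hex : forall T, (T <= L)%nat ->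
    exists K, forall t, (t < T)%nat -> s / INR L < f t K).
  { induction T as [|T IH]; intros HT; [exists 0%nat; lia|].
    destruct IH as [K HK]; [lia|].
    destruct (classic (forall K, f T K <= s / INR L)) as [Ha|Ha].
    { exfalso; apply Hn; exists T; auto. }
    apply not_all_ex_not in Ha as [K' HK'].
    exists (K + K')%nat; intros t Ht.
    destruct (Nat.eq_dec t T) as [->|].
    - apply Rlt_le_trans with (f T K'); [lra | apply Hmon; lia].
    - apply Rlt_le_trans with (f t K); [apply HK; lia | apply Hmon; lia]. }
  destruct (Hex L (le_n L)) as [K HK].
  apply (Rlt_not_le _ _ (HK 0%nat HL)); clear Hn Hex.
  assert (HL' : 0 < INR L) by now apply lt_0_INR.
  destruct L as [|L]; [lia|].
  pose proof (Hs K) as HsK; rewrite sumR_succ_l in HsK.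
  pose proof (sumR_le L (fun _ => s / INR (S L)) (fun t => f (S t) K)
    ltac:(intros t Ht; left; apply HK; lia)) as Hsum.
  rewrite sumR_const in Hsum.
  assert (E : s = s / INR (S L) + INR L * (s / INR (S L)))
    by (rewrite S_INR in *; field; lra).
  lra.
Qed.

(** Outer measure need not be additive on arbitrary sets, so the cover itself is cut. Along each
    coordinate some slab of width [1 / L] receives at most the average share of the cover, and
    periodicity carries that share to the first slab. *)
Lemma outer_periodic_cell N D L s : (1 <= N)%nat -> (0 < L)%nat ->
  (forall x (z : nat -> Z), D x -> D (fun i => x i + IZR (z i) / INR L)) ->
  outer N (fun x => D x /\ forall i, (i < N)%nat -> 0 <= x i <= 1) s ->
  forall a, outer N (fun x => D x /\ cell N (/ INR L) (fun _ => 0) a x) (s * (/ INR L) ^ N).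
Proof.
  intros HN HL Hinv H0 a.
  set (d := / INR L).
  assert (HL' : 0 < INR L) by now apply lt_0_INR.
  assert (Hd : 0 < d) by now apply Rinv_0_lt_compat.
  assert (HLd : INR L * d = 1) by (unfold d; field; lra).
  assert (H : forall j, (j <= N)%nat ->
    outer N (fun x => D x /\ forall i, (i < N)%nat ->
      ((i < j)%nat -> 0 <= x i <= d) /\ ((j <= i)%nat -> 0 <= x i <= 1)) (s * d ^ j)).
  2:{ assert (Ht : outer N (fun x => D (fun i => 1 * x i + - (d * IZR (a i))) /\
        forall i, (i < N)%nat -> 0 <= 1 * x i + - (d * IZR (a i)) <= d) (s * d ^ N / 1 ^ N)).
      { apply outer_affine with (D := fun x => D x /\ forall i, (i < N)%nat -> 0 <= x i <= d);
          [lra|].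
        apply outer_mono with (3 := H N (le_n N)); [|lra].
        intros x [Hx Hb]; split; auto; intros i Hi; split; intros; [now apply Hb|lia]. }
      apply outer_mono with (3 := Ht); [|rewrite pow1; lra].
      intros x [Hx Hc]; split.
      - replace (fun i => 1 * x i + - (d * IZR (a i)))
          with (fun i => x i + IZR (- a i) / INR L); [now apply Hinv|].
        extensionality i; rewrite opp_IZR; unfold d; field; lra.
      - intros i Hi; specialize (Hc i Hi); lra. }
  induction j as [|j IH]; intros Hj.
  - apply outer_mono with (3 := H0); [|simpl; lra].
    intros x [Hx Hb]; split; auto; intros i Hi; apply Hb; auto; lia.
  - destruct (IH ltac:(lia)) as (lo & hi & Hcov & Hsum).
    (* The box [k] clipped to the slab [t] and moved back to [[0, d]] in coordinate [j]. *)
    set (lo' := fun t k i => if (i =? j)%nat then Rmax (lo k j) (INR t * d) - INR t * d else lo k i).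
    set (hi' := fun t k i => if (i =? j)%nat then Rmin (hi k j) (INR t * d + d) - INR t * d else hi k i).
    destruct (exists_below_average L
      (fun t K => sumR K (fun k => bvol N (lo' t k) (hi' t k))) (s * d ^ j) HL)
      as (t & Ht & Hbound).
    + intros t K K' HK; apply sumR_widen; auto; intros; apply bvol_nonneg.
    + intros K; apply Rle_trans with (2 := Hsum K).
      rewrite sumR_swap; apply sumR_le; intros k _.
      unfold bvol; rewrite (prodR_split N j) by lia.
      set (rest := prodR N (fun i => if (i =? j)%nat then 1 else Rmax 0 (hi k i - lo k i))).
      rewrite (sumR_ext _ _ (fun t => rest *
        Rmax 0 (Rmin (hi k j) (INR t * d + d) - Rmax (lo k j) (INR t * d)))).
      2:{ intros t _; rewrite (prodR_split N j) by lia; f_equal.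
          - apply prodR_ext; intros i _; unfold lo', hi'.
            destruct (Nat.eqb_spec i j); auto.
          - unfold lo', hi'; rewrite Nat.eqb_refl; f_equal; ring. }
      rewrite sumR_scal; apply Rmult_le_compat_l; [|apply sum_clip_le; lra].
      apply prodR_nonneg; intros i _; destruct (Nat.eqb_spec i j); [lra|apply Rmax_l].
    + exists (lo' t), (hi' t); split.
      2:{ intros K; eapply Rle_trans; [apply Hbound|]; simpl; right; unfold d; field; lra. }
      intros x [Hx Hb].
      pose proof (proj1 (Hb j ltac:(lia)) ltac:(lia)) as Hxj.
      assert (HtL : INR t + 1 <= INR L) by (rewrite <- S_INR; apply le_INR; lia).
      assert (HtL' : INR t * d + d <= 1) by nra.
      assert (Ht0 : 0 <= INR t * d) by (apply Rmult_le_pos; [apply pos_INR|lra]).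
      destruct (Hcov (fun i => x i + IZR (if (i =? j)%nat then Z.of_nat t else 0) / INR L))
        as [k Hk].
      * split; [now apply Hinv|]; intros i Hi.
        destruct (Nat.eqb_spec i j) as [->|Hne].
        -- split; [lia|]; intros _.
           rewrite <- INR_IZR_INZ.
           change (INR t / INR L) with (INR t * d); lra.
        -- replace (x i + 0 / INR L) with (x i) by (field; lra).
           split; intros Hij; apply Hb; lia.
      * exists k; intros i Hi; specialize (Hk i Hi); unfold lo', hi'; simpl in Hk.
        destruct (Nat.eq_dec i j) as [Hij|Hne];
          [apply Nat.eqb_eq in Hij as E | apply Nat.eqb_neq in Hne as E]; rewrite E in *.
        -- subst i; rewrite <- INR_IZR_INZ in Hk.
           change (INR t / INR L) with (INR t * d) in Hk.
           unfold Rmax, Rmin; repeat destruct Rle_dec; lra.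
        -- replace (x i + 0 / INR L) with (x i) in Hk by (field; lra); auto.
Qed.

(** * Prime divisors *)

Lemma prime_divisor_exists a : (1 < a)%Z -> exists r, prime r /\ (r | a)%Z.
Proof.
  intros Ha; assert (H0 : (0 <= a)%Z) by lia; revert Ha.
  pattern a; revert a H0; apply Z_lt_induction; intros a IH Ha.
  destruct (prime_dec a) as [Hp|Hp]; [exists a; split; auto using Z.divide_refl|].
  destruct (not_prime_divide a Ha Hp) as (b & Hb & Hba).
  destruct (IH b) as (r & Hr & Hrb); try lia.
  exists r; split; auto; eapply Z.divide_trans; eauto.
Qed.

Lemma prime_not_divide_1 r : prime r -> ~ (r | 1)%Z.
Proof.
  intros Hr H; pose proof (prime_ge_2 r Hr); apply Z.divide_pos_le in H; lia.
Qed.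

Lemma remove_prime P d : prime P -> (0 < d)%Z -> (P | d)%Z ->
  exists e, (0 < e)%Z /\ (e * P <= d)%Z /\ ~ (P | e)%Z /\
    forall r, prime r -> r <> P -> (r | d)%Z -> (r | e)%Z.
Proof.
  intros HP Hd; pose proof (prime_ge_2 P HP).
  assert (H0 : (0 <= d)%Z) by lia; revert Hd.
  pattern d; revert d H0; apply Z_lt_induction; intros d IH Hd [d' Hd'].
  assert (Hpos : (0 < d')%Z) by nia.
  assert (Hprimes : forall r, prime r -> r <> P -> (r | d)%Z -> (r | d')%Z).
  { intros r Hr Hne Hrd; rewrite Hd' in Hrd; apply prime_mult in Hrd as [|Hrd]; auto.
    apply prime_div_prime in Hrd; tauto. }
  destruct (Zdivide_dec P d') as [Hdiv|Hdiv].
  - destruct (IH d' ltac:(nia) Hpos Hdiv) as (e & He & HeP & Hn & Hr).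
    exists e; split; [auto|split; [nia|split; auto]].
  - exists d'; split; [auto|split; [nia|split; auto]].
Qed.

Lemma prime_divides_fact (M : nat) r : (0 < r <= Z.of_nat M)%Z -> (r | Z.of_nat (fact M))%Z.
Proof.
  induction M as [|M IH]; intros Hr; [lia|].
  simpl fact; change (fact M + M * fact M)%nat with (S M * fact M)%nat.
  rewrite Nat2Z.inj_mul.
  destruct (Z.eq_dec r (Z.of_nat (S M))) as [->|].
  - apply Z.divide_factor_l.
  - apply Z.divide_mul_r, IH; lia.
Qed.

Lemma exists_one_mod (e : Z) v : (0 < e)%Z -> exists t : Z, v <= IZR (1 + t * e) < v + IZR e.
Proof.
  intros He; assert (He' : 0 < IZR e) by now apply IZR_lt.
  exists (Zceil ((v - 1) / IZR e)).
  pose proof (Zceil_bound ((v - 1) / IZR e)) as [H1 H2].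
  rewrite plus_IZR, mult_IZR.
  set (c := IZR (Zceil _)) in *.
  assert (E : v - 1 = (v - 1) / IZR e * IZR e) by (field; lra).
  nra.
Qed.

Lemma divide_one_plus r t e : prime r -> (r | e)%Z -> ~ (r | 1 + t * e)%Z.
Proof.
  intros Hr He H; apply (prime_not_divide_1 r Hr).
  replace 1%Z with (1 + t * e - t * e)%Z by lia.
  apply Z.divide_sub_r; auto; now apply Z.divide_mul_r.
Qed.

(* If [d] has a prime factor [P > 4/eps], write [d = P^k e]: of two consecutive integers
   congruent to 1 modulo [e <= d/P] one is prime to [d].  Otherwise all prime factors
   of [d] are bounded and the integers congruent to 1 modulo a fixed factorial do. *)
Lemma coprime_in_short_interval eps : 0 < eps ->
  exists H0 : Z, forall d h v, (0 < d <= h)%Z -> (H0 <= h)%Z ->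
    exists p : Z, v <= IZR p < v + eps * IZR h /\
      forall r, prime r -> (r | d)%Z -> ~ (r | p)%Z.
Proof.
  intros He.
  (* A prime factor above [4 / eps] leaves [e] below [eps * h / 4], so the window holds two
     consecutive terms of the progression. *)
  set (M := Z.to_nat (up (4 / eps))).
  assert (HM : 4 / eps < INR M).
  { destruct (archimed (4 / eps)) as [H1 _].
    assert (0 < 4 / eps) by (apply Rdiv_lt_0_compat; lra).
    unfold M; rewrite INR_IZR_INZ, Z2Nat.id; [lra|]; apply le_IZR; lra. }
  set (F := Z.of_nat (fact M)).
  assert (HF : (0 < F)%Z) by (unfold F; pose proof (lt_O_fact M); lia).
  (* The threshold is on [h], later the norm of [q], because [d], later the gcd of [q], may stay
     small. Beyond it the window contains a full period [F]. *)
  exists (up (IZR F / eps)); intros d h v Hd Hh.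
  destruct (classic (exists P, prime P /\ (P | d)%Z /\ (Z.of_nat M < P)%Z))
    as [(P & HP & HPd & HMP)|Hsmall].
  - destruct (remove_prime P d HP ltac:(lia) HPd) as (e & He0 & HeP & Hne & Hr).
    assert (Hlen : 2 * IZR e <= eps * IZR h).
    { assert (HPe : INR M * IZR e <= IZR h).
      { rewrite INR_IZR_INZ, <- mult_IZR; apply IZR_le; nia. }
      assert (He' : 0 < IZR e) by now apply IZR_lt.
      assert (4 / eps * IZR e <= IZR h) by nra.
      replace (IZR e) with (eps / 4 * (4 / eps * IZR e)) by (field; lra).
      apply Rle_trans with (2 * (eps / 4 * IZR h)); [|].
      - apply Rmult_le_compat_l; [lra|]; apply Rmult_le_compat_l; lra.
      - assert (0 < IZR h) by (apply IZR_lt; lia); nra. }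
    assert (He' : 0 < IZR e) by now apply IZR_lt.
    assert (Hcop : forall s, ~ (P | 1 + s * e)%Z ->
      forall r, prime r -> (r | d)%Z -> ~ (r | 1 + s * e)%Z).
    { intros s Hs r Hrp Hrd; destruct (Z.eq_dec r P) as [->|Hne']; auto.
      apply divide_one_plus; auto. }
    destruct (exists_one_mod e v He0) as [t Ht].
    destruct (Zdivide_dec P (1 + t * e)) as [Hdiv|Hdiv].
    + exists (1 + (t + 1) * e)%Z; split.
      * replace (1 + (t + 1) * e)%Z with ((1 + t * e) + e)%Z by ring.
        rewrite plus_IZR; lra.
      * apply Hcop; intros Hdiv'; apply Hne.
        replace e with ((1 + (t + 1) * e) - (1 + t * e))%Z by ring.
        now apply Z.divide_sub_r.
    + exists (1 + t * e)%Z; split; [lra | auto].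
  - destruct (exists_one_mod F v HF) as [t Ht].
    exists (1 + t * F)%Z; split.
    + destruct (archimed (IZR F / eps)) as [H1 _]; apply IZR_le in Hh.
      assert (IZR F <= eps * IZR h).
      { replace (IZR F) with (eps * (IZR F / eps)) by (field; lra).
        apply Rmult_le_compat_l; lra. }
      lra.
    + intros r Hr Hrd; apply divide_one_plus; auto.
      apply prime_divides_fact; pose proof (prime_ge_2 r Hr); split; [lia|].
      apply Z.nlt_ge; intros Hlt; apply Hsmall; eauto.
Qed.

(** * Systems of linear forms *)

(* The matrix entry [X i j] is the coordinate [i * m + j]. *)
Definition lin (n m : nat) (q : list Z) (x : pt) (j : nat) : R :=
  sumR n (fun i => IZR (nth i q 0%Z) * x (i * m + j)%nat).

(** The sum norm is convenient because the sum of [q_i sgn(q_i)] equals it, which makes the move to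
    an exact zero of the forms explicit. *)
Definition norm1 (q : list Z) : Z := fold_right (fun z s => (Z.abs z + s)%Z) 0%Z q.

Definition all_div (r : Z) (q : list Z) : Prop := forall z, In z q -> (r | z)%Z.

(** Infinitude is expressed by solutions of unbounded norm. [p] is a function, so that its entries
    come from choice and can be shifted freely; [c] records the rescaling of [Psi]. *)
Definition approx (n m : nat) (Psi : list Z -> R) (F : (nat -> Z) -> list Z -> Prop)
  (c : R) (x : pt) : Prop :=
  forall H : Z, exists p q, length q = n /\ (H < norm1 q)%Z /\ F p q /\
    forall j, (j < m)%nat -> Rabs (lin n m q x j + IZR (p j)) < c * Psi q.

Definition unit_cube (N : nat) (x : pt) : Prop := forall i, (i < N)%nat -> 0 <= x i <= 1.

(* The coprimality conditions of the three sets are local: for every prime [r] dividing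
   [q], a condition [Om r p] on [p] modulo [r]. *)
Definition locally_ok (Om : Z -> (nat -> Z) -> Prop) (p : nat -> Z) (q : list Z) : Prop :=
  forall r, prime r -> all_div r q -> Om r p.

(** With [c = 1] the first clause says that only the first [m] residues modulo [r] matter. Other
    units account for scaling by a factor prime to [r], the second clause for a shift that makes all
    numerators units. *)
Definition unit_invariant (m : nat) (Om : Z -> (nat -> Z) -> Prop) : Prop :=
  (forall r c p p', prime r -> ~ (r | c)%Z ->
     (forall j, (j < m)%nat -> (r | p' j - c * p j)%Z) -> Om r p -> Om r p') /\
  (forall r p, prime r -> (forall j, (j < m)%nat -> ~ (r | p j)%Z) -> Om r p).

Lemma sumR_nth (f : Z -> R) q :
  sumR (length q) (fun i => f (nth i q 0%Z)) = fold_right (fun z s => f z + s) 0 q.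
Proof.
  induction q as [|a q IH]; [reflexivity|].
  simpl length; rewrite sumR_succ_l; simpl; now rewrite <- IH.
Qed.

Lemma norm1_sumR n q : length q = n ->
  IZR (norm1 q) = sumR n (fun i => Rabs (IZR (nth i q 0%Z))).
Proof.
  intros <-; rewrite (sumR_nth (fun z => Rabs (IZR z))).
  induction q as [|a q IH]; simpl; auto.
  now rewrite plus_IZR, IH, abs_IZR.
Qed.

Lemma div_add_small m i j : (j < m)%nat -> ((i * m + j) / m = i)%nat.
Proof. intros Hj; rewrite Nat.div_add_l, Nat.div_small by lia; lia. Qed.

Lemma mod_add_small m i j : (j < m)%nat -> ((i * m + j) mod m = j)%nat.
Proof. intros Hj; rewrite Nat.add_comm, Nat.Div0.mod_add, Nat.mod_small; auto. Qed.

Lemma index_lt n m i j : (i < n)%nat -> (j < m)%nat -> (i * m + j < n * m)%nat.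
Proof. nia. Qed.

Lemma lin_affine n m q x w g j :
  lin n m q (fun t => g * x t + w t) j = g * lin n m q x j + lin n m q w j.
Proof.
  unfold lin; rewrite <- sumR_scal, <- sumR_plus; apply sumR_ext; intros; ring.
Qed.

Lemma approx_mono n m Psi (F G : (nat -> Z) -> list Z -> Prop) c x :
  (forall p q, F p q -> G p q) -> approx n m Psi F c x -> approx n m Psi G c x.
Proof.
  intros HFG Hx H; destruct (Hx H) as (p & q & Hq & HH & HF & Hin).
  exists p, q; auto.
Qed.

(* For [q] in the class [K], solutions [p] for [x] give locally admissible solutions
   [g p - u] for [g x + w]. *)
Definition affine_compatible (n m : nat) (K : list Z -> Prop) (g : Z) (w : pt) : Prop :=
  forall q, length q = n -> K q -> exists u : nat -> Z,
     (forall j, (j < m)%nat -> IZR (u j) = lin n m q w j) /\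
     forall r, prime r -> all_div r q ->
       (~ (r | g)%Z /\ forall j, (j < m)%nat -> (r | u j)%Z) \/
       ((r | g)%Z /\ forall j, (j < m)%nat -> ~ (r | u j)%Z).

(** Modulo a prime [r] dividing [q], the new numerators are a unit times the old ones if [r] does
    not divide [g]; otherwise they are [-u], with no entry divisible by [r]. The two clauses of
    [unit_invariant] settle these cases. *)
Lemma approx_affine n m Psi Om K (g : Z) w c x :
  unit_invariant m Om -> (0 < g)%Z ->
  affine_compatible n m K g w ->
  approx n m Psi (fun p q => locally_ok Om p q /\ K q) c x ->
  approx n m Psi (fun p q => locally_ok Om p q /\ K q) (IZR g * c)
    (fun t => IZR g * x t + w t).
Proof.
  intros [Hsc Hun] Hg Hw Hx H.
  destruct (Hx H) as (p & q & Hq & HH & [Hok HK] & Hin).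
  destruct (Hw q Hq HK) as (u & Hu & Hr).
  exists (fun j => g * p j - u j)%Z, q; split; [auto|split; [auto|split; [split; auto|]]].
  - intros r Hpr Hdiv; destruct (Hr r Hpr Hdiv) as [[Hrg Hru]|[Hrg Hru]].
    + apply (Hsc r g p); auto.
      intros j Hj; replace (g * p j - u j - g * p j)%Z with (- u j)%Z by ring.
      apply Z.divide_opp_r; auto.
    + apply Hun; auto; intros j Hj Hd; apply (Hru j Hj).
      replace (u j) with (g * p j - (g * p j - u j))%Z by ring.
      apply Z.divide_sub_r; auto; now apply Z.divide_mul_l.
  - intros j Hj; rewrite lin_affine, minus_IZR, mult_IZR, Hu by auto.
    assert (Hg' : 0 < IZR g) by now apply IZR_lt.
    replace (IZR g * lin n m q x j + lin n m q w j + (IZR g * IZR (p j) - lin n m q w j))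
      with (IZR g * (lin n m q x j + IZR (p j))) by ring.
    rewrite Rabs_mult, (Rabs_right (IZR g)), Rmult_assoc by lra.
    apply Rmult_lt_compat_l; auto.
Qed.

Fixpoint sumZ (n : nat) (f : nat -> Z) : Z :=
  match n with O => 0%Z | S k => (sumZ k f + f k)%Z end.

Lemma IZR_sumZ n f : IZR (sumZ n f) = sumR n (fun i => IZR (f i)).
Proof. induction n as [|n IH]; simpl; auto; now rewrite plus_IZR, IH. Qed.

Lemma divide_sumZ r n f : (forall i, (i < n)%nat -> (r | f i)%Z) -> (r | sumZ n f)%Z.
Proof.
  induction n as [|n IH]; intros H; simpl; [apply Z.divide_0_r|].
  apply Z.divide_add_r; auto.
Qed.

(** The translation changes the forms by integers divisible by every prime dividing [q], so the
    compensating shift of [p] leaves all local conditions intact. *)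
Lemma approx_translate n m Psi Om K (l : Z) (z : nat -> Z) c x :
  unit_invariant m Om -> (0 < l)%Z ->
  (forall q, K q -> forall a, In a q -> exists b, a = (l * b)%Z /\
     forall r, prime r -> all_div r q -> (r | b)%Z) ->
  approx n m Psi (fun p q => locally_ok Om p q /\ K q) c x ->
  approx n m Psi (fun p q => locally_ok Om p q /\ K q) c (fun t => x t + IZR (z t) / IZR l).
Proof.
  intros HOm Hl HK Hx.
  assert (Hl' : 0 < IZR l) by now apply IZR_lt.
  replace c with (IZR 1 * c) by (simpl; ring).
  replace (fun t => x t + IZR (z t) / IZR l)
    with (fun t => IZR 1 * x t + IZR (z t) / IZR l) by (extensionality t; ring).
  apply approx_affine; auto; [lia|].
  intros q Hq HKq.
  assert (Hb : forall i, exists b, (i < n)%nat ->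
    nth i q 0%Z = (l * b)%Z /\ forall r, prime r -> all_div r q -> (r | b)%Z).
  { intros i; destruct (Nat.lt_ge_cases i n) as [Hi|Hi]; [|exists 0%Z; lia].
    destruct (HK q HKq (nth i q 0%Z)) as (b & Hb); [apply nth_In; lia|].
    exists b; auto. }
  destruct (functional_choice _ Hb) as [b Hb'].
  exists (fun j => sumZ n (fun i => (b i * z (i * m + j)%nat)%Z)); split.
  - intros j Hj; rewrite IZR_sumZ; apply sumR_ext; intros i Hi.
    destruct (Hb' i Hi) as [-> _]; rewrite !mult_IZR; field; lra.
  - intros r Hr Hdiv; left; split; [now apply prime_not_divide_1|].
    intros j Hj; apply divide_sumZ; intros i Hi; apply Z.divide_mul_l.
    now apply Hb'.
Qed.

Lemma approx_translate_int n m Psi Om K (z : nat -> Z) c x :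
  unit_invariant m Om ->
  approx n m Psi (fun p q => locally_ok Om p q /\ K q) c x ->
  approx n m Psi (fun p q => locally_ok Om p q /\ K q) c (fun t => x t + IZR (z t)).
Proof.
  intros HOm Hx.
  replace (fun t => x t + IZR (z t)) with (fun t => x t + IZR (z t) / IZR 1)
    by (extensionality t; field).
  apply approx_translate; auto; [lia|].
  intros q _ a Ha; exists a; split; [ring|]; auto.
Qed.

(** * Limsup sets when [Psi q] is small compared with the norm of [q] *)

Definition small (n : nat) (Psi : list Z -> R) : Prop :=
  forall eps, 0 < eps -> exists H : Z, forall q, length q = n -> (H < norm1 q)%Z ->
    Psi q <= eps * IZR (norm1 q).

Lemma outer_unit_cube N (D : pt -> Prop) : (1 <= N)%nat ->
  (forall x, D x -> unit_cube N x) -> outer N D 1.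
Proof.
  intros HN HD.
  apply outer_mono with (3 := outer_box N (fun _ => 0) (fun _ => 1) HN); [exact HD|].
  unfold bvol; rewrite (prodR_ext _ _ (fun _ => 1)), prodR_const, pow1; [lra|].
  intros; rewrite Rmax_right; lra.
Qed.

(* Points of the left-hand side see, at arbitrarily small scales, a proportional hole:
   [y := x - (qx+p) sgn(q) / |q|_1] solves [qy+p = 0] exactly. *)
Lemma approx_scale n m Psi F c : (1 <= n * m)%nat -> 0 < c -> (forall q, 0 < Psi q) ->
  small n Psi ->
  null (n * m) (fun x => unit_cube (n * m) x /\ approx n m Psi F c x /\
                         ~ approx n m Psi F 1 x).
Proof.
  intros HN Hc HPsi Hsmall.
  (* Stratify by a bound [k] on the norms of solutions for [Psi] itself: a point with a solution of
     larger norm is outside [D k]. *)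
  set (D := fun (k : nat) x => unit_cube (n * m) x /\ approx n m Psi F c x /\
    forall p q, length q = n -> F p q ->
      (forall j, (j < m)%nat -> Rabs (lin n m q x j + IZR (p j)) < 1 * Psi q) ->
      (norm1 q <= Z.of_nat k)%Z).
  apply null_mono with (fun x => exists k, D k x).
  { intros x (Hu & Hx & Hn); apply not_all_ex_not in Hn as [H HH].
    exists (Z.to_nat H); split; [auto|split; auto].
    intros p q Hq HF Hin; apply Z.nlt_ge; intros Hlt; apply HH.
    exists p, q; split; [auto|split; [lia|split; auto]]. }
  apply null_bigcup; intros k.
  apply null_porous with (2 * c) 1; auto; [lra| |].
  { apply outer_unit_cube; auto; intros x Hx; apply Hx. }
  intros x (_ & Hx & _) eps Heps.
  destruct (Hsmall eps Heps) as [H1 HH1].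
  destruct (Hx (Z.max (Z.of_nat k) H1)) as (p & q & Hq & HH & HF & Hin).
  set (v := fun j => lin n m q x j + IZR (p j)) in *.
  assert (HQ : 0 < IZR (norm1 q)) by (apply IZR_lt; lia).
  pose proof (HPsi q) as HP.
  pose proof (HH1 q Hq ltac:(lia)) as HPe.
  set (Q := IZR (norm1 q)) in *.
  set (y := fun t => x t - IZR (Z.sgn (nth (t / m) q 0%Z)) * v (t mod m)%nat / Q).
  (* Within this radius of [y] the forms move by at most [Psi q / 2] from 0, so [(p, q)] is a
     solution of norm above [k]. The distance from [x] to [y] is at most [c * Psi q / Q], that is
     [2 * c] radii. *)
  exists (Psi q / (2 * Q)), y.
  assert (Hrho : Psi q / (2 * Q) * (2 * Q) = Psi q) by (field; lra).
  assert (Hrho0 : 0 < Psi q / (2 * Q)) by (apply Rdiv_lt_0_compat; lra).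
  split; [split; [auto|nra]|split].
  - intros t Ht; unfold y.
    assert (Hm : (0 < m)%nat) by nia.
    replace (x t - _) with (IZR (Z.sgn (nth (t / m) q 0%Z)) * (v (t mod m)%nat / Q))
      by (field; lra).
    rewrite Rabs_mult.
    assert (Hv : Rabs (v (t mod m)%nat / Q) <= c * Psi q / Q).
    { unfold Rdiv; rewrite Rabs_mult, (Rabs_right (/ Q))
        by (apply Rle_ge; left; now apply Rinv_0_lt_compat).
      apply Rmult_le_compat_r; [left; now apply Rinv_0_lt_compat|].
      left; apply Hin; apply Nat.mod_upper_bound; lia. }
    replace (2 * c * (Psi q / (2 * Q))) with (c * Psi q / Q) by (field; lra).
    assert (Hs : Rabs (IZR (Z.sgn (nth (t / m) q 0%Z))) <= 1).
    { rewrite <- abs_IZR; apply IZR_le; lia. }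
    pose proof (Rabs_pos (v (t mod m)%nat / Q)).
    pose proof (Rabs_pos (IZR (Z.sgn (nth (t / m) q 0%Z)))); nra.
  - intros z Hz (_ & _ & Hbound).
    assert (Hle : (norm1 q <= Z.of_nat k)%Z); [|lia].
    apply (Hbound p q Hq HF); intros j Hj.
    assert (Hy0 : lin n m q y j + IZR (p j) = 0).
    { assert (E : lin n m q y j = lin n m q x j - v j / Q * Q).
      { unfold Q at 2; rewrite (norm1_sumR n q Hq), <- sumR_scal.
        unfold lin at 2; replace (sumR n _ - _) with
          (sumR n (fun i => IZR (nth i q 0%Z) * x (i * m + j)%nat) +
           - 1 * sumR n (fun i => v j / Q * Rabs (IZR (nth i q 0%Z)))) by ring.
        rewrite <- sumR_scal, <- sumR_plus.
        unfold lin at 1; apply sumR_ext; intros i Hi; unfold y.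
        rewrite div_add_small, mod_add_small by auto.
        rewrite <- abs_IZR, <- Z.sgn_abs, mult_IZR.
        field; lra. }
      rewrite E; unfold v; field; lra. }
    replace (lin n m q z j + IZR (p j)) with (lin n m q (fun t => 1 * z t + -1 * y t) j).
    2:{ rewrite lin_affine.
        replace (lin n m q (fun t => -1 * y t) j) with (-1 * lin n m q y j); [lra|].
        unfold lin; rewrite <- sumR_scal; apply sumR_ext; intros; ring. }
    apply Rle_lt_trans with (Psi q / (2 * Q) * Q); [|nra].
    unfold Q at 2; rewrite (norm1_sumR n q Hq), <- sumR_scal.
    unfold lin; clear - Hz Hj.
    assert (Habs : forall N f, Rabs (sumR N f) <= sumR N (fun i => Rabs (f i))).
    { intros N f; induction N as [|N IH]; simpl; [rewrite Rabs_R0; lra|].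
      eapply Rle_trans; [apply Rabs_triang|]; lra. }
    eapply Rle_trans; [apply Habs|]; apply sumR_le; intros i Hi.
    rewrite Rabs_mult, Rmult_comm; apply Rmult_le_compat_r; [apply Rabs_pos|].
    pose proof (Hz (i * m + j)%nat (index_lt n m i j Hi Hj)).
    replace (1 * z (i * m + j)%nat + -1 * y (i * m + j)%nat)
      with (z (i * m + j)%nat - y (i * m + j)%nat) by ring; lra.
Qed.

(* The union over all scales [g^nu] is stable under [x -> g x + w], whose iterates map
   small grid cells onto integer translates of the unit cube. *)
Lemma null_of_expanding n m Psi Om K g w s : (1 <= n * m)%nat ->
  (forall q, 0 < Psi q) -> small n Psi -> unit_invariant m Om ->
  (2 <= g)%Z -> affine_compatible n m K g w -> s < 1 ->
  outer (n * m) (fun x => unit_cube (n * m) x /\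
    approx n m Psi (fun p q => locally_ok Om p q /\ K q) 1 x) s ->
  null (n * m) (fun x => unit_cube (n * m) x /\
    approx n m Psi (fun p q => locally_ok Om p q /\ K q) 1 x).
Proof.
  intros HN HPsi Hsmall HOm Hg Hexp Hs Hout.
  set (A := approx n m Psi (fun p q => locally_ok Om p q /\ K q)) in *.
  assert (Hg2 : 2 <= IZR g) by now apply IZR_le.
  pose proof (outer_nonneg _ _ _ Hout) as Hs0.
  (* Room between [s] and 1, so that null sets can be charged [(1 - s) / 2]. *)
  set (s' := (1 + s) / 2).
  set (U := fun x => unit_cube (n * m) x /\ exists nu : nat, A (IZR g ^ nu) x).
  assert (HU : outer (n * m) U s').
  { apply outer_mono with (s := s + (1 - s) / 2)
     (E := fun x => (unit_cube (n * m) x /\ A 1 x) \/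
        exists nu : nat, unit_cube (n * m) x /\ A (IZR g ^ nu) x /\ ~ A 1 x);
     [|unfold s'; lra|].
    - intros x (Hx & nu & Hnu); destruct (classic (A 1 x)); [now left|].
      right; exists nu; auto.
    - apply outer_union; auto.
      apply (null_bigcup _ (fun nu x => unit_cube (n * m) x /\ A (IZR g ^ nu) x /\ ~ A 1 x));
        [|lra].
      intros nu; apply approx_scale; auto; apply pow_lt; lra. }
  apply null_mono with U.
  { intros x [Hx HA]; split; auto; exists 0%nat; exact HA. }
  (* The [k]-th iterate of [x -> g x + w] is [x -> g^k x + W k]. *)
  set (W := fix W k i := match k with O => 0 | S k' => IZR g * W k' i + w i end).
  assert (Hiter : forall k c x, A c x -> A (IZR g ^ k * c) (fun i => IZR g ^ k * x i + W k i)).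
  { induction k as [|k IH]; intros c x Hx.
    - simpl; replace (1 * c) with c by ring.
      replace (fun i => 1 * x i + 0) with x; auto; extensionality i; ring.
    - simpl; rewrite Rmult_assoc.
      replace (fun i => IZR g * IZR g ^ k * x i + (IZR g * W k i + w i))
        with (fun i => IZR g * (IZR g ^ k * x i + W k i) + w i) by (extensionality i; ring).
      apply approx_affine; auto; [lia|]; apply IH; auto. }
  apply null_of_cells with s' s'; auto; [unfold s'; lra|].
  intros eta Heta.
  destruct (pow_lt_1_zero (/ IZR g)) with (y := eta) as [k Hk]; auto.
  { rewrite Rabs_right; [|apply Rle_ge; left; apply Rinv_0_lt_compat; lra].
    rewrite <- Rinv_1; apply Rinv_lt_contravar; lra. }
  specialize (Hk k (le_n k)); rewrite pow_inv in Hk.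
  assert (Hgk : 0 < IZR g ^ k) by (apply pow_lt; lra).
  assert (Hd : 0 < / IZR g ^ k) by now apply Rinv_0_lt_compat.
  rewrite Rabs_right in Hk by lra.
  (* With this offset the cell [a] is the preimage, under the [k]-th iterate, of the half-open unit
     cube translated by [a]. *)
  exists (/ IZR g ^ k), (fun i => - W k i); split; [auto|]; intros a.
  apply outer_mono with (s := s' / (IZR g ^ k) ^ (n * m))
    (E := fun x => U (fun i => IZR g ^ k * x i + (W k i + IZR (- a i)))).
  - intros x [(Hx & nu & Hnu) Hc]; split.
    + intros i Hi; specialize (Hc i Hi); rewrite opp_IZR.
      assert (Hx' : x i = / IZR g ^ k * (IZR g ^ k * x i)) by (field; lra).
      rewrite Hx' in Hc; destruct Hc as [Hc1 Hc2].
      apply Rmult_le_reg_l in Hc1; auto; apply Rmult_lt_reg_l in Hc2; auto; lra.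
    + exists (k + nu)%nat; rewrite pow_add.
      replace (fun i => IZR g ^ k * x i + (W k i + IZR (- a i)))
        with (fun i => (IZR g ^ k * x i + W k i) + IZR (- a i)) by (extensionality i; ring).
      apply (approx_translate_int n m Psi Om K (fun i => - a i)%Z); auto.
      now apply Hiter.
  - rewrite pow_inv; right; reflexivity.
  - now apply outer_affine.
Qed.

(** The primes dividing such a [q] differ from [l], so [l] is a unit modulo each of them. *)
Lemma affine_compatible_coprime n m l : (0 < n)%nat -> prime l ->
  affine_compatible n m (fun q => ~ all_div l q) l (fun _ => 0).
Proof.
  intros Hn Hl q Hq Hnd; exists (fun _ => 0%Z); split.
  - intros j _; unfold lin; rewrite (sumR_ext _ _ (fun _ => 0)), sumR_const; [ring|].
    intros; ring.
  - intros r Hr Hdiv; left; split.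
    + intros Hrl; apply Hnd; apply prime_div_prime in Hrl; subst; auto.
    + intros; apply Z.divide_0_r.
Qed.

(** The shift adds [b = q_i0 / l] to every form. By the hypothesis on [l^2], [l] does not divide
    [b], while the other primes dividing [q] still do. *)
Lemma affine_compatible_exact n m l i0 : (i0 < n)%nat -> prime l ->
  affine_compatible n m (fun q => all_div l q /\ ~ (l * l | nth i0 q 0)%Z) l
    (fun t => if (t / m =? i0)%nat then / IZR l else 0).
Proof.
  intros Hi0 Hl q Hq [Hdiv Hnd].
  pose proof (prime_ge_2 l Hl) as Hl2.
  assert (Hl0 : 0 < IZR l) by (apply IZR_lt; lia).
  assert (Hin : In (nth i0 q 0%Z) q) by (apply nth_In; lia).
  destruct (Hdiv _ Hin) as [b Hb].
  exists (fun _ => b); split.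
  - intros j Hj; unfold lin.
    rewrite (sumR_ext _ _ (fun i => if (i =? i0)%nat then IZR (nth i q 0%Z) * / IZR l else 0)).
    + rewrite (sumR_indicator n (fun i => IZR (nth i q 0%Z) * / IZR l)) by auto.
      rewrite Hb, mult_IZR; field; lra.
    + intros i Hi; rewrite div_add_small by auto.
      destruct (i =? i0)%nat; ring.
  - intros r Hr Hrd; destruct (Z.eq_dec r l) as [->|Hne]; [right|left]; split.
    + apply Z.divide_refl.
    + intros j _ [c Hc]; apply Hnd; exists c; rewrite Hb, Hc; ring.
    + intros Hrl; apply Hne, prime_div_prime; auto.
    + intros j _; specialize (Hrd _ Hin); rewrite Hb in Hrd.
      apply prime_mult in Hrd as [|Hrd]; auto.
      apply prime_div_prime in Hrd; tauto.
Qed.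

(** When [l] divides [q], an index [t < n] names an entry that [l^2] does not divide; [t = n] and
    [t = n + 1] stand for the other two kinds. One of the finitely many classes recurs at unbounded
    norm. *)
Lemma approx_split n m Psi (F : (nat -> Z) -> list Z -> Prop) l x :
  approx n m Psi F 1 x ->
  exists t, (t < n + 2)%nat /\
   approx n m Psi (fun p q => F p q /\
     if (t <? n)%nat then all_div l q /\ ~ (l * l | nth t q 0)%Z
     else if (t =? n)%nat then ~ all_div l q else all_div (l * l) q) 1 x.
Proof.
  intros Hx.
  set (K := fun t q => if (t <? n)%nat then all_div l q /\ ~ (l * l | nth t q 0)%Z
     else if (t =? n)%nat then ~ all_div l q else all_div (l * l) q).
  destruct (pigeonhole (n + 2) (fun t k => exists p q, length q = n /\
    norm1 q = Z.of_nat k /\ (F p q /\ K t q) /\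
    forall j, (j < m)%nat -> Rabs (lin n m q x j + IZR (p j)) < 1 * Psi q))
    as (t & Ht & Hinf).
  - intros k0; destruct (Hx (Z.of_nat k0)) as (p & q & Hq & HH & HF & Hin).
    exists (Z.to_nat (norm1 q)); split; [lia|].
    assert (HK : exists t, (t < n + 2)%nat /\ K t q).
    { unfold K; destruct (classic (all_div l q)) as [Hd|Hd].
      2:{ exists n; rewrite Nat.ltb_irrefl, Nat.eqb_refl; split; auto; lia. }
      destruct (classic (all_div (l * l) q)) as [Hd2|Hd2].
      { exists (S n); destruct (Nat.ltb_spec (S n) n), (Nat.eqb_spec (S n) n); try lia.
        split; auto; lia. }
      apply not_all_ex_not in Hd2 as [z Hz]; apply imply_to_and in Hz as [Hz Hnd].
      destruct (In_nth q z 0%Z Hz) as (t & Ht & <-).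
      exists t; split; [lia|]; rewrite Hq in Ht; apply Nat.ltb_lt in Ht as ->; auto. }
    destruct HK as (t & Ht & HK); exists t; split; auto.
    exists p, q; split; [auto|split; [|split; auto]].
    rewrite Z2Nat.id; lia.
  - exists t; split; auto; intros H.
    destruct (Hinf (S (Z.to_nat H))) as (k & Hk & p & q & Hq & Hn & HF & Hin).
    exists p, q; split; [auto|split; [lia|auto]].
Qed.

(* For every prime [l], the solutions with [l^2 | q] give a [1/l]-periodic set that carries
   all of the measure, so the density in cells of side [1/l] is constant. *)
Lemma null_of_small n m Psi Om s : (1 <= n)%nat -> (1 <= m)%nat ->
  (forall q, 0 < Psi q) -> small n Psi -> unit_invariant m Om -> s < 1 ->
  outer (n * m) (fun x => unit_cube (n * m) x /\ approx n m Psi (locally_ok Om) 1 x) s ->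
  null (n * m) (fun x => unit_cube (n * m) x /\ approx n m Psi (locally_ok Om) 1 x).
Proof.
  intros Hn Hm HPsi Hsmall HOm Hs Hout.
  assert (HN : (1 <= n * m)%nat) by nia.
  pose proof (outer_nonneg _ _ _ Hout) as Hs0.
  set (s' := (1 + s) / 2).
  apply null_of_cells with s' s; auto; [unfold s'; lra|].
  intros eta Heta.
  (* Euclid's argument: a prime factor of [M! + 1] exceeds [M], here taken large enough that
     [1 / l < eta]. *)
  destruct (prime_divisor_exists (Z.of_nat (fact (Z.to_nat (up (/ eta) + 2))) + 1))
    as (l & Hl & Hldiv).
  { pose proof (lt_O_fact (Z.to_nat (up (/ eta) + 2))); lia. }
  assert (Hbig : / eta < IZR l).
  { destruct (archimed (/ eta)) as [Hup _].
    assert (Hpos : 0 < / eta) by now apply Rinv_0_lt_compat.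
    assert (Hup0 : (0 < up (/ eta))%Z) by (apply lt_IZR; lra).
    pose proof (prime_ge_2 l Hl).
    apply Rlt_trans with (1 := Hup), IZR_lt, Z.nle_gt; intros Hle.
    apply (prime_not_divide_1 l Hl).
    replace 1%Z with (Z.of_nat (fact (Z.to_nat (up (/ eta) + 2))) + 1
      - Z.of_nat (fact (Z.to_nat (up (/ eta) + 2))))%Z by ring.
    apply Z.divide_sub_r; auto; apply prime_divides_fact; lia. }
  pose proof (prime_ge_2 l Hl) as Hl2.
  assert (HlZ : INR (Z.to_nat l) = IZR l) by (rewrite INR_IZR_INZ, Z2Nat.id; auto; lia).
  assert (Hl0 : 0 < IZR l) by (apply IZR_lt; lia).
  set (sq := fun x => approx n m Psi (fun p q => locally_ok Om p q /\ all_div (l * l) q) 1 x).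
  assert (Hsub : forall K : list Z -> Prop, outer (n * m) (fun x => unit_cube (n * m) x /\
     approx n m Psi (fun p q => locally_ok Om p q /\ K q) 1 x) s).
  { intros K; apply outer_mono with (3 := Hout); [|lra].
    intros x [Hx HA]; split; auto; revert HA; apply approx_mono; tauto. }
  assert (Hrest : null (n * m) (fun x => unit_cube (n * m) x /\
     approx n m Psi (locally_ok Om) 1 x /\ ~ sq x)).
  { apply null_mono with (fun x => exists t : nat, (t <= n)%nat /\ unit_cube (n * m) x /\
      approx n m Psi (fun p q => locally_ok Om p q /\
       if (t <? n)%nat then all_div l q /\ ~ (l * l | nth t q 0)%Z
       else ~ all_div l q) 1 x).
    - intros x (Hx & HA & Hnsq); destruct (approx_split n m Psi _ l x HA) as (t & Ht & HAt).
      destruct (Nat.ltb_spec t n) as [Hlt|Hge].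
      + exists t; split; [lia|]; split; auto.
        apply Nat.ltb_lt in Hlt as ->; auto.
      + destruct (Nat.eqb_spec t n) as [->|Hne]; [|now destruct Hnsq].
        exists n; rewrite Nat.ltb_irrefl; auto.
    - apply null_bigcup; intros t eps Heps.
      destruct (Nat.ltb_spec t n) as [Hlt|Hge].
      + apply (null_mono _ _ (fun x => unit_cube (n * m) x /\ approx n m Psi (fun p q =>
          locally_ok Om p q /\ (all_div l q /\ ~ (l * l | nth t q 0)%Z)) 1 x)); auto;
          [tauto|].
        apply null_of_expanding with l (fun i => if (i / m =? t)%nat then / IZR l else 0) s;
          auto.
        now apply affine_compatible_exact.
      + apply (null_mono _ _ (fun x => unit_cube (n * m) x /\ approx n m Psi (fun p q =>
          locally_ok Om p q /\ ~ all_div l q) 1 x)); auto; [tauto|].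
        apply null_of_expanding with l (fun _ => 0) s; auto.
        apply affine_compatible_coprime; auto. }
  exists (/ INR (Z.to_nat l)), (fun _ => 0); rewrite HlZ; split.
  { split; [now apply Rinv_0_lt_compat|].
    rewrite <- (Rinv_inv eta); apply Rinv_lt_contravar; auto.
    apply Rmult_lt_0_compat; auto; now apply Rinv_0_lt_compat. }
  intros a.
  assert (Hcell := outer_periodic_cell (n * m) sq (Z.to_nat l) s HN ltac:(lia)).
  rewrite HlZ in Hcell.
  assert (Hd : 0 < (/ IZR l) ^ (n * m)) by (apply pow_lt; now apply Rinv_0_lt_compat).
  apply outer_mono with
    (s := s * (/ IZR l) ^ (n * m) + (1 - s) / 2 * (/ IZR l) ^ (n * m))
    (E := fun x => (sq x /\ cell (n * m) (/ IZR l) (fun _ => 0) a x) \/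
      (unit_cube (n * m) x /\ approx n m Psi (locally_ok Om) 1 x /\ ~ sq x)).
  - intros x [[Hx HA] Hc]; destruct (classic (sq x)); [left | right]; auto.
  - unfold s'; right; field; lra.
  - apply outer_union; auto.
    + apply Hcell.
      * intros x z Hx; apply approx_translate; auto; [lia|].
        intros q Hq b Hb; destruct (Hq b Hb) as [c Hc].
        (* The quotient of the entry by [l] retains a factor [l], hence every prime dividing [q]. *)
        exists (c * l)%Z; split; [lia|].
        intros r Hr Hrd; specialize (Hrd b Hb).
        replace b with (l * (c * l))%Z in Hrd by lia.
        apply prime_mult in Hrd as [Hrd|]; auto; now apply Z.divide_mul_r.
      * apply outer_mono with (3 := Hsub (all_div (l * l))); [|lra].
        intros x [Hx Hu]; split; auto.
    + apply Hrest; apply Rmult_lt_0_compat; lra.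
Qed.

(** * Gcd and norm of integer vectors, and the case of large [Psi] *)

Lemma gcdl_divide q z : In z q -> (gcdl q | z)%Z.
Proof.
  induction q as [|a q IH]; [intros []|]; intros [->|Hz]; simpl; [apply Z.gcd_divide_l|].
  eapply Z.divide_trans; [apply Z.gcd_divide_r | auto].
Qed.

Lemma gcdl_greatest q r : all_div r q -> (r | gcdl q)%Z.
Proof.
  induction q as [|a q IH]; intros H; simpl; [apply Z.divide_0_r|].
  apply Z.gcd_greatest; [apply H; now left | apply IH; intros z Hz; apply H; now right].
Qed.

Lemma gcdl_nonneg q : (0 <= gcdl q)%Z.
Proof. destruct q; simpl; [lia | apply Z.gcd_nonneg]. Qed.

Lemma gcdl_eq_1 q : (exists z, In z q /\ z <> 0%Z) ->
  (gcdl q = 1%Z <-> forall r, prime r -> ~ all_div r q).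
Proof.
  intros (z & Hz & Hz0); split.
  - intros H1 r Hr Hd; apply (prime_not_divide_1 r Hr); rewrite <- H1.
    now apply gcdl_greatest.
  - intros H; pose proof (gcdl_nonneg q).
    assert (gcdl q <> 0%Z).
    { intros E; apply Hz0; apply Z.divide_0_l; rewrite <- E; now apply gcdl_divide. }
    destruct (Z.eq_dec (gcdl q) 1) as [|Hne]; auto.
    destruct (prime_divisor_exists (gcdl q)) as (r & Hr & Hrd); [lia|].
    exfalso; apply (H r Hr); intros y Hy.
    eapply Z.divide_trans; [apply Hrd | now apply gcdl_divide].
Qed.

Lemma norm1_nonneg q : (0 <= norm1 q)%Z.
Proof. induction q; simpl; lia. Qed.

Lemma norm1_ge q z : In z q -> (Z.abs z <= norm1 q)%Z.
Proof.
  induction q as [|a q IH]; [intros []|]; intros [->|Hz]; simpl; pose proof (norm1_nonneg q); [lia|].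
  specialize (IH Hz); lia.
Qed.

Lemma norm1_pos q : (0 < norm1 q)%Z <-> exists z, In z q /\ z <> 0%Z.
Proof.
  split.
  - induction q as [|a q IH]; simpl; intros H; [lia|].
    destruct (Z.eq_dec a 0) as [->|Ha]; [|eauto].
    destruct IH as (z & Hz & Hz0); [lia|]; eauto.
  - intros (z & Hz & Hz0); pose proof (norm1_ge q z Hz); lia.
Qed.

(** Each [p_j] is taken prime to the gcd of [q] in a window of length [eps] times the norm, starting
    at minus the [j]-th form; this is shorter than [Psi q]. The choice is possible at every
    point. *)
Lemma approx_of_large n m Psi Om x : unit_invariant m Om -> ~ small n Psi ->
  approx n m Psi (locally_ok Om) 1 x.
Proof.
  intros [_ Hun] Hlarge H.
  apply not_all_ex_not in Hlarge as [eps Heps]; apply imply_to_and in Heps as [Heps Hinf].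
  destruct (coprime_in_short_interval eps Heps) as [H0 Hcop].
  (* The 0 in the maximum forces [q] to be nonzero, so that its gcd is positive. *)
  pose proof (not_ex_all_not _ _ Hinf (Z.max 0 (Z.max H H0))) as Hq.
  apply not_all_ex_not in Hq as [q Hq]; apply imply_to_and in Hq as [Hq Hq'].
  apply imply_to_and in Hq' as [HH Hlt]; apply Rnot_le_lt in Hlt.
  assert (Hnz : exists z, In z q /\ z <> 0%Z) by (apply norm1_pos; lia).
  assert (Hgcd : (0 < gcdl q <= norm1 q)%Z).
  { destruct Hnz as (z & Hz & Hz0).
    pose proof (gcdl_nonneg q); pose proof (gcdl_divide q z Hz) as Hd.
    pose proof (norm1_ge q z Hz); pose proof (Zdivide_bounds _ _ Hd Hz0).
    assert (gcdl q <> 0%Z) by (intros E; rewrite E in Hd; apply Z.divide_0_l in Hd; auto).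
    lia. }
  destruct (functional_choice _ (fun j => Hcop (gcdl q) (norm1 q) (- lin n m q x j) Hgcd
    ltac:(lia))) as [p Hp].
  exists p, q; split; [auto|split; [lia|split]].
  - intros r Hr Hdiv; apply Hun; auto; intros j _.
    apply (Hp j); auto; now apply gcdl_greatest.
  - intros j _; destruct (Hp j) as [Hpj _]; apply Rabs_def1; lra.
Qed.

(** Each cell is a scaled copy of the cube, so the given cover is reproduced in every cell with the
    same density [s]. *)
Lemma null_unit_cube N s : (1 <= N)%nat -> s < 1 ->
  outer N (unit_cube N) s -> null N (unit_cube N).
Proof.
  intros HN Hs H; pose proof (outer_nonneg _ _ _ H).
  apply null_of_cells with s s; auto.
  intros eta Heta; exists (eta / 2), (fun _ => 0).
  split; [lra|]; intros a.
  apply outer_mono with (s := s / (/ (eta / 2)) ^ N)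
    (E := fun x => unit_cube N (fun i => / (eta / 2) * x i + - IZR (a i))).
  - intros x [_ Hc] i Hi; specialize (Hc i Hi).
    assert (Hi2 : 0 < / (eta / 2)) by (apply Rinv_0_lt_compat; lra).
    assert (E : x i = eta / 2 * (/ (eta / 2) * x i)) by (field; lra).
    rewrite E in Hc; destruct Hc as [Hc1 Hc2].
    apply Rmult_le_reg_l in Hc1; [|lra]; apply Rmult_lt_reg_l in Hc2; lra.
  - rewrite pow_inv; unfold Rdiv at 1; rewrite Rinv_inv; lra.
  - apply outer_affine; auto; apply Rinv_0_lt_compat; lra.
Qed.

Lemma null_of_outer_lt_1 n m Psi Om s : (1 <= n)%nat -> (1 <= m)%nat ->
  (forall q, 0 < Psi q) -> unit_invariant m Om -> s < 1 ->
  outer (n * m) (fun x => unit_cube (n * m) x /\ approx n m Psi (locally_ok Om) 1 x) s ->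
  null (n * m) (fun x => unit_cube (n * m) x /\ approx n m Psi (locally_ok Om) 1 x).
Proof.
  intros Hn Hm HPsi HOm Hs Hout.
  destruct (classic (small n Psi)) as [Hsm|Hsm]; [now apply null_of_small with s|].
  apply null_mono with (unit_cube (n * m)); [tauto|].
  apply null_unit_cube with s; auto; [nia|].
  apply outer_mono with (3 := Hout); [|lra].
  intros x Hx; split; auto; now apply approx_of_large.
Qed.

(** * Matrices *)

Definition flatten (m : nat) (X : mat) : pt := fun t => X (t / m)%nat (t mod m)%nat.

Definition unflatten (m : nat) (x : pt) : mat := fun i j => x (i * m + j)%nat.

Lemma flatten_entry m X i j : (j < m)%nat -> flatten m X (i * m + j)%nat = X i j.
Proof. intros Hj; unfold flatten; now rewrite div_add_small, mod_add_small. Qed.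

Lemma flattenK m x : flatten m (unflatten m x) = x.
Proof.
  extensionality t; unfold flatten, unflatten; f_equal.
  rewrite Nat.mul_comm; symmetry; apply Nat.div_mod_eq.
Qed.

Lemma forall_flat n m (Q : nat -> Prop) :
  (forall i j, (i < n)%nat -> (j < m)%nat -> Q (i * m + j)%nat) <->
  (forall t, (t < n * m)%nat -> Q t).
Proof.
  split; intros H.
  - intros t Ht; assert (m <> 0%nat) by nia.
    rewrite (Nat.div_mod_eq t m), Nat.mul_comm; apply H.
    + apply Nat.Div0.div_lt_upper_bound; lia.
    + now apply Nat.mod_upper_bound.
  - intros i j Hi Hj; apply H; now apply index_lt.
Qed.

Lemma in_cube_flatten n m X : in_cube n m X <-> unit_cube (n * m) (flatten m X).
Proof.
  unfold unit_cube; rewrite <- (forall_flat n m (fun t => 0 <= flatten m X t <= 1)).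
  split; intros H i j Hi Hj; specialize (H i j Hi Hj); rewrite flatten_entry in *; auto.
Qed.

Lemma vol_flatten n m B : vol n m B = bvol (n * m) (flatten m (lo B)) (flatten m (hi B)).
Proof.
  unfold vol, bvol; rewrite <- prodR_nested.
  apply prodR_ext; intros i _; apply prodR_ext; intros j Hj.
  now rewrite !flatten_entry.
Qed.

Lemma in_box_flatten n m B X : in_box n m B X <->
  forall t, (t < n * m)%nat -> flatten m (lo B) t <= flatten m X t <= flatten m (hi B) t.
Proof.
  rewrite <- (forall_flat n m (fun t =>
    flatten m (lo B) t <= flatten m X t <= flatten m (hi B) t)).
  split; intros H i j Hi Hj; specialize (H i j Hi Hj); rewrite !flatten_entry in *; auto.
Qed.

Lemma outer_le_flatten n m (A : mat -> Prop) (D : pt -> Prop) s :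
  (forall X, A X <-> D (flatten m X)) -> outer_le n m A s <-> outer (n * m) D s.
Proof.
  intros HAD; split.
  - intros (C & Hc & Hs).
    exists (fun k => flatten m (lo (C k))), (fun k => flatten m (hi (C k))); split.
    + intros x Hx; destruct (Hc (unflatten m x)) as [k Hk].
      { apply HAD; now rewrite flattenK. }
      exists k; rewrite (in_box_flatten n m), flattenK in Hk; exact Hk.
    (* [sum_f_R0] with index [K] has [K + 1] terms, whereas [sumR] may be empty; the empty sum is
       compared with one nonnegative term. *)
    + intros [|K]; [simpl; apply Rle_trans with (2 := Hs 0%nat); simpl|].
      * rewrite vol_flatten; apply bvol_nonneg.
      * rewrite <- sum_f_R0_sumR; apply Rle_trans with (2 := Hs K); right.
        apply sum_eq; intros k _; now rewrite vol_flatten.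
  - intros (lo & hi & Hc & Hs).
    exists (fun k => Box (unflatten m (lo k)) (unflatten m (hi k))); split.
    + intros X HX; destruct (Hc (flatten m X)) as [k Hk]; [now apply HAD|].
      exists k; apply in_box_flatten; simpl; now rewrite !flattenK.
    + intros K; rewrite sum_f_R0_sumR; apply Rle_trans with (2 := Hs (S K)); right.
      apply sumR_ext; intros k _; rewrite vol_flatten; simpl; now rewrite !flattenK.
Qed.

Lemma qXp_lin n m q X p j : (j < m)%nat ->
  qXp n q X p j = lin n m q (flatten m X) j + IZR (nth j p 0%Z).
Proof.
  intros Hj; unfold qXp, lin; f_equal; apply sumR_ext; intros i _.
  now rewrite flatten_entry.
Qed.

Lemma supnorm_lt n m q X p s : 0 < s ->
  supnorm_qXp n m q X p < s <->
  forall j, (j < m)%nat -> Rabs (lin n m q (flatten m X) j + IZR (nth j p 0%Z)) < s.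
Proof.
  intros Hs; unfold supnorm_qXp.
  transitivity (forall j, In j (seq 0 m) -> Rabs (qXp n q X p j) < s).
  - induction (seq 0 m) as [|a l IH]; simpl; [split; intros; [tauto|auto]|].
    split.
    + intros H j [<-|Hj].
      * eapply Rle_lt_trans; [apply Rmax_l | apply H].
      * apply IH; auto; eapply Rle_lt_trans; [apply Rmax_r | apply H].
    + intros H; apply Rmax_lub_lt; auto; apply IH; auto.
  - split; intros H j Hj.
    + rewrite <- qXp_lin by auto; apply H, in_seq; lia.
    + apply in_seq in Hj; rewrite (qXp_lin n m) by lia; apply H; lia.
Qed.

Lemma bounded_vectors_finite k B : exists L : list (list Z), forall v,
  length v = k -> (forall z, In z v -> (Z.abs z <= B)%Z) -> In v L.
Proof.
  induction k as [|k [L HL]].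
  - exists (nil :: nil); intros [|a v] Hv _; [now left | discriminate].
  - set (ints := map (fun i => (Z.of_nat i - B)%Z) (seq 0 (Z.to_nat (2 * B + 1)))).
    exists (map (fun c => fst c :: snd c) (list_prod ints L)).
    intros [|a v] Hv Hb; [discriminate|].
    apply in_map_iff; exists (a, v); split; auto; apply in_prod.
    + pose proof (Hb a ltac:(now left)); apply in_map_iff.
      exists (Z.to_nat (a + B)); split; [lia | apply in_seq; lia].
    + apply HL; [now injection Hv | intros z Hz; apply Hb; now right].
Qed.

Lemma finite_fibers (P : list Z -> list Z -> Prop) (l : list (list Z)) :
  (forall q, exists L, forall p, P p q -> In p L) ->
  exists L, forall p q, In q l -> P p q -> In (p, q) L.
Proof.
  intros H; induction l as [|a l [L HL]]; [exists nil; intros ? ? []|].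
  destruct (H a) as [La HLa].
  exists (map (fun p => (p, a)) La ++ L); intros p q [<-|Hq] HP; apply in_or_app.
  - left; apply in_map_iff; eauto.
  - right; auto.
Qed.

(** For fixed [q] the inequality confines [p] to a bounded box, so there are infinitely many pairs
    exactly when the norms of the [q] involved are unbounded. *)
Lemma infinitely_many_approx n m Psi Om X (P : list Z -> list Z -> Prop) :
  (forall q, 0 < Psi q) -> unit_invariant m Om ->
  (forall p q, P p q <->
     ineq n m Psi X p q /\ locally_ok Om (fun j => nth j p 0%Z) q) ->
  infinitely_many P <-> approx n m Psi (locally_ok Om) 1 (flatten m X).
Proof.
  intros HPsi HOm HP; split.
  - intros Hinf H; apply NNPP; intros Hn; apply Hinf.
    assert (Hle : forall p q, P p q -> (norm1 q <= H)%Z).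
    { intros p q Hpq; apply HP in Hpq as [(_ & Hq & _ & Hin) Hok].
      apply Z.nlt_ge; intros Hlt; apply Hn.
      exists (fun j => nth j p 0%Z), q; split; [auto|split; [auto|split; auto]].
      rewrite Rmult_1_l; now apply supnorm_lt. }
    destruct (bounded_vectors_finite n H) as [l Hl].
    destruct (finite_fibers P l) as [L HL].
    + intros q.
      assert (HB : exists B, forall j, (j < m)%nat ->
        Rabs (lin n m q (flatten m X) j) <= B).
      { generalize m at 1; intros k; induction k as [|k [B HB]]; [exists 0; intros; lia|].
        exists (Rmax B (Rabs (lin n m q (flatten m X) k))); intros j Hj.
        destruct (Nat.eq_dec j k) as [->|]; [apply Rmax_r|].
        eapply Rle_trans; [apply HB; lia | apply Rmax_l]. }
      destruct HB as [B HB].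
      destruct (bounded_vectors_finite m (up (B + Psi q))) as [L HL].
      exists L; intros p Hpq; apply HP in Hpq as [(Hp & _ & _ & Hin) _].
      apply HL; auto; intros z Hz; apply In_nth with (d := 0%Z) in Hz as (j & Hj & <-).
      unfold zvec in Hp; rewrite Hp in Hj.
      pose proof (proj1 (supnorm_lt n m q X p (Psi q) (HPsi q)) Hin j Hj) as Hj1.
      pose proof (HB j Hj) as Hj2; destruct (archimed (B + Psi q)) as [Hup _].
      apply le_IZR; rewrite abs_IZR.
      replace (IZR (nth j p 0%Z)) with ((lin n m q (flatten m X) j + IZR (nth j p 0%Z))
        + - lin n m q (flatten m X) j) by ring.
      eapply Rle_trans; [apply Rabs_triang|]; rewrite Rabs_Ropp.
      lra.
    + exists L; intros p q Hpq; apply HL; auto; apply Hl.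
      * now apply HP in Hpq as [(_ & Hq & _) _].
      * intros z Hz; pose proof (norm1_ge q z Hz); pose proof (Hle p q Hpq); lia.
  - intros Hx [L HL].
    assert (HB : exists B, forall c, In c L -> (norm1 (snd c) <= B)%Z).
    { clear HL; induction L as [|c L [B HB]]; [exists 0%Z; intros ? []|].
      exists (Z.max B (norm1 (snd c))); intros c' [<-|Hc]; [lia|].
      pose proof (HB c' Hc); lia. }
    destruct HB as [B HB].
    destruct (Hx (Z.max 0 B)) as (p & q & Hq & HH & Hok & Hin).
    assert (Hnth : forall j, (j < m)%nat -> nth j (map p (seq 0 m)) 0%Z = p j).
    { intros j Hj; rewrite nth_indep with (d' := p 0%nat) by (now rewrite length_map, length_seq).
      now rewrite map_nth, seq_nth. }
    assert (Hpq : P (map p (seq 0 m)) q).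
    { apply HP; split; [split; [|split; [auto|split]]|].
      - unfold zvec; now rewrite length_map, length_seq.
      - apply norm1_pos; lia.
      - apply supnorm_lt; auto; intros j Hj; rewrite Hnth by auto.
        rewrite Rmult_1_l in Hin; auto.
      (* Turning [p] into a list keeps its first [m] entries, so unit invariance with the unit 1
         transfers the local condition. *)
      - intros r Hr Hd; apply (proj1 HOm r 1%Z p); auto using prime_not_divide_1.
        intros j Hj; rewrite Hnth by auto; exists 0%Z; ring. }
    pose proof (HB _ (HL _ _ Hpq)) as Hle; simpl in Hle; lia.
Qed.

Lemma zero_or_one_locally_ok n m Psi Om (A : mat -> Prop) (P : mat -> list Z -> list Z -> Prop) :
  (1 <= n)%nat -> (1 <= m)%nat -> (forall q, 0 < Psi q) -> unit_invariant m Om ->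
  (forall X, A X <-> in_cube n m X /\ infinitely_many (P X)) ->
  (forall X p q, P X p q <->
     ineq n m Psi X p q /\ locally_ok Om (fun j => nth j p 0%Z) q) ->
  zero_or_one n m A.
Proof.
  intros Hn Hm HPsi HOm HA HP.
  set (D := fun x => unit_cube (n * m) x /\ approx n m Psi (locally_ok Om) 1 x).
  assert (HAD : forall X, A X <-> D (flatten m X)).
  { intros X; unfold D; rewrite HA, in_cube_flatten.
    now rewrite (infinitely_many_approx n m Psi Om X (P X)). }
  destruct (classic (measure_one n m A)) as [H1|H1]; [now right|left].
  (* The upper half of [measure_one] holds for every subset of the cube; so the lower half fails,
     and this is a cover of total volume below 1. *)
  assert (Hs : exists s, s < 1 /\ outer_le n m A s).
  { apply NNPP; intros Hn1; apply H1; split.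
    - intros eps Heps; apply (outer_le_flatten n m A D); auto.
      apply outer_mono with (s := 1) (E := D); auto; [lra|].
      apply outer_unit_cube; [nia|]; intros x Hx; apply Hx.
    - intros s Hs; apply Rnot_lt_le; intros Hlt; apply Hn1; eauto. }
  destruct Hs as (s & Hs1 & Hs).
  intros eps Heps; apply (outer_le_flatten n m A D); auto.
  apply null_of_outer_lt_1 with s; auto.
  now apply (outer_le_flatten n m A D).
Qed.

Lemma prime_not_divide_scale r c a b : prime r -> ~ (r | c)%Z ->
  (r | b - c * a)%Z -> ~ (r | a)%Z -> ~ (r | b)%Z.
Proof.
  intros Hr Hc Hd Ha Hb; assert (H : (r | c * a)%Z).
  { replace (c * a)%Z with (b - (b - c * a))%Z by ring; now apply Z.divide_sub_r. }
  apply prime_mult in H; tauto.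
Qed.

Theorem theorem1 :
  forall (m n : nat), (1 <= m)%nat -> (1 <= n)%nat ->
  forall Psi : list Z -> R, (forall q, 0 < Psi q) ->
    zero_or_one n m (A_set n m Psi) /\
    zero_or_one n m (A'_set n m Psi) /\
    zero_or_one n m (A''_set n m Psi).
Proof.
  intros m n Hm Hn Psi HPsi; split; [|split].
  - apply zero_or_one_locally_ok with Psi (fun _ _ => True)
      (fun X p q => ineq n m Psi X p q); auto.
    + split; auto.
    + reflexivity.
    + intros X p q; unfold locally_ok; tauto.
  (* The gcd of all entries is 1 exactly when every prime dividing [q] misses some [p_j]. *)
  - apply zero_or_one_locally_ok with Psi (fun r p => exists j, (j < m)%nat /\ ~ (r | p j)%Z)
      (fun X p q => ineq n m Psi X p q /\ gcdl (p ++ q) = 1%Z); auto.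
    + split.
      * intros r c p p' Hr Hc Hd (j & Hj & Hpj); exists j; split; auto.
        apply prime_not_divide_scale with c (p j); auto.
      * intros r p Hr H; exists 0%nat; split; auto.
    + reflexivity.
    + intros X p q.
      assert (H : ineq n m Psi X p q -> (gcdl (p ++ q) = 1%Z <->
        locally_ok (fun r p => exists j, (j < m)%nat /\ ~ (r | p j)%Z)
          (fun j => nth j p 0%Z) q)); [|tauto].
      intros (Hp & _ & (z & Hz & Hz0) & _).
      rewrite gcdl_eq_1 by (exists z; split; auto; apply in_or_app; now right).
      unfold locally_ok; split; intros H r Hr.
      * intros Hd; apply NNPP; intros Hnj; apply (H r Hr); intros y Hy.
        apply in_app_or in Hy as [Hy|Hy]; auto.
        apply In_nth with (d := 0%Z) in Hy as (j & Hj & <-).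
        apply NNPP; intros Hnd; apply Hnj; exists j; rewrite Hp in Hj; auto.
      * intros Hd; destruct (H r Hr) as (j & Hj & Hnd).
        { intros y Hy; apply Hd, in_or_app; now right. }
        apply Hnd, Hd, in_or_app; left; apply nth_In; now rewrite Hp.
  (* Here every prime dividing [q] must miss all the [p_j]. *)
  - apply zero_or_one_locally_ok with Psi (fun r p => forall j, (j < m)%nat -> ~ (r | p j)%Z)
      (fun X p q => ineq n m Psi X p q /\
         forall j, (j < m)%nat -> gcdl (nth j p 0%Z :: q) = 1%Z); auto.
    + split; auto.
      intros r c p p' Hr Hc Hd H j Hj; apply prime_not_divide_scale with c (p j); auto.
    + reflexivity.
    + intros X p q.
      assert (H : ineq n m Psi X p q ->
        ((forall j, (j < m)%nat -> gcdl (nth j p 0%Z :: q) = 1%Z) <->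
        locally_ok (fun r p => forall j, (j < m)%nat -> ~ (r | p j)%Z)
          (fun j => nth j p 0%Z) q)); [|tauto].
      intros (_ & _ & (z & Hz & Hz0) & _); unfold locally_ok.
      assert (Hnz : forall j, exists y, In y (nth j p 0%Z :: q) /\ y <> 0%Z)
        by (intros j; exists z; split; auto; now right).
      split.
      * intros H r Hr Hd j Hj Hrj; specialize (H j Hj).
        apply (proj1 (gcdl_eq_1 _ (Hnz j)) H r Hr); intros y [<-|Hy]; auto.
      * intros H j Hj; apply gcdl_eq_1; auto; intros r Hr Hd.
        apply (H r Hr) with j; auto; [|apply Hd; now left].
        intros y Hy; apply Hd; now right.
Qed.
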